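(* For every integer $k>0$, $$\mathrm{Q}_{2k,2}(1)=\mathrm{H}_{2k,2}[X;q,t]=\left(s_{(k-1)}(q,t)+s_{(k-2)}(q,t)\right)s_2+\left(s_{(k)}(q,t)+s_{(k-1)}(q,t)\right)s_{11},$$ and $$\mathrm{Q}_{2,2k}(1)=\mathrm{H}_{2,2k}[X;q,t]=\sum_{r=0}^{k}\left(s_{(k-r)}(q,t)+s_{(k-r-1)}(q,t)\right)s_{2^r1^{2k-2r}}.$$
   Context: Notation for $q,t$: $[n]_{q,t}=\frac{q^n-t^n}{q-t}=q^{n-1}+q^{n-2}t+\dots+t^{n-1}$ for $n\ge 1$. For integers $a,b$ the $(q,t)$-Schur function is $s_{(a,b)}(q,t)=(qt)^b[a-b+1]_{q,t}$ if $a\ge b\ge 0$, and $s_{(a,b)}(q,t)=0$ otherwise; $s_{(a)}(q,t):=s_{(a,0)}(q,t)$ (so $s_{(a)}(q,t)=0$ for $a<0$). $s_\lambda$ denotes the Schur function in $X=(x_1,x_2,\dots)$; $2^r1^j$ is the partition with $r$ parts $2$ and $j$ parts $1$. Operators $\mathrm{Q}_{m,n}$ (Gorsky–Negut, extended by Bergeron–Garsia–Leven–Xin): let $M=(1-q)(1-t)$ and, in plethystic notation, $D_kF[X]=F[X+M/z]\sum_{i\ge0}(-z)^ie_i[X]\big|_{z^k}$. Set $\mathrm{Q}_{1,n}=(-1)^nD_n$ for $n\ge0$. For $m>1$ and $(m,n)$ coprime, let $(a,b)$ be the lattice point of the $m\times n$ rectangle closest to the diagonal $y=\frac nm x$ with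 $cb-da>0$ where $(c,d)=(m-a,n-b)$, and set $\mathrm{Q}_{m,n}=\frac1M(\mathrm{Q}_{c,d}\mathrm{Q}_{a,b}-\mathrm{Q}_{a,b}\mathrm{Q}_{c,d})$. For non-coprime $(m,n)$, choose a lattice point $(a,b)$ of the rectangle, not on the diagonal, closest to it and with the same positivity condition, and set $\mathrm{Q}_{m,n}=\frac1M[\mathrm{Q}_{m-a,n-b},\mathrm{Q}_{a,b}]$; this is independent of the choice. Combinatorial side: an $(m,n)$-Dyck path is a north/east lattice path from $(0,0)$ to $(m,n)$ weakly above $y=\frac nm x$. An $(m,n)$-parking function $\pi$ is such a path $\Pi(\pi)$ whose $n$ north steps are labeled bijectively by $1,\dots,n$ (''cars'', each occupying the cell just right of its north step), increasing upward within each column; $\mathcal{PF}_{m,n}$ is the set of these. With $d=\gcd(m,n)$, the cell with lower-left corner $(x,y)$ has rank $my-nx+\lfloor xd/m\rfloor$; a car's rank is that of its cell. $\mathrm{ides}(\pi)=\{i:\mathrm{rank}(i)<\mathrm{rank}(i+1)\}=\{i_1<\dots<i_r\}$ and $\mathrm{pides}(\pi)=(i_1,i_2-i_1,\dots,n-i_r)$. $\mathrm{area}(\pi)$ is the number of full cells between the path and the diagonal. $\lambda(P)$ is the partition (English notation) of cells of the rectangle above $P$; for $c\in\lambda(P)$, $\mathrm{arm}(c)$, $\mathrm{leg}(c)$ count cells of $\lambda(P)$ to its right and below it. $\mathrm{pdinv}(P)=\#\{c\in\lambda(P):\frac{\mathrm{arm}(c)}{\mathrm{leg}(c)+1}\le\frac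 mn<\frac{\mathrm{arm}(c)+1}{\mathrm{leg}(c)}\}$ (with $x/0=\infty$). $\mathrm{tdinv}(\pi)=\#\{\text{cars } i<j:\mathrm{rank}(i)<\mathrm{rank}(j)<\mathrm{rank}(i)+m\}$, $\mathrm{maxdinv}(P)$ is the maximum of tdinv over parking functions on $P$, and $\mathrm{dinv}(\pi)=\mathrm{tdinv}(\pi)+\mathrm{pdinv}(\Pi(\pi))-\mathrm{maxdinv}(\Pi(\pi))$. Writing $(m,n)=(km_0,kn_0)$ with $m_0,n_0$ coprime, $\mathrm{ret}(\pi)$ is the least $i\ge1$ with $\Pi(\pi)$ through $(im_0,in_0)$; $[r]_{1/t}=1+t^{-1}+\dots+t^{-(r-1)}$. With $F_\alpha$ Gessel's fundamental quasisymmetric function, $\mathrm{H}_{m,n}[X;q,t]=\sum_{\pi\in\mathcal{PF}_{m,n}}[\mathrm{ret}(\pi)]_{1/t}t^{\mathrm{area}(\pi)}q^{\mathrm{dinv}(\pi)}F_{\mathrm{pides}(\pi)}[X]$.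
   Formalization: The splitting condition cb-da>0 in the definition of Q_{m,n} is replaced by da-cb>0 (with a and c both positive), since as written Q_{2k,2}(1) and Q_{2,2k}(1) come out as the negatives of the stated values. *)

(* Defs.v *)
From HB Require Import structures.
From mathcomp Require Import all_boot all_order all_fingroup all_algebra fraction finmap zify.
(* [mpoly] last: its [mmap], [mcoeff], ... shadow those of [monalg]. *)
From mathcomp Require Import monalg mpoly.

Set Implicit Arguments.
Unset Strict Implicit.
Unset Printing Implicit Defensive.

Import GRing.Theory.

Local Open Scope ring_scope.

(** * The coefficient field Q(q,t) *)

Definition Qqt : fieldType := {fraction (mpoly 2 rat)}.

Definition q : Qqt := tofrac 'X_ord0.
Definition t : Qqt := tofrac 'X_ord_max.

Definition qtM : Qqt := (1 - q) * (1 - t).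

Definition qtint (n : int) : Qqt := (q ^ n - t ^ n) / (q - t).

Definition qtschur (a b : int) : Qqt :=
  if 0 <= b <= a then (q * t) ^ b * qtint (a - b + 1) else 0.

(** * Symmetric functions over Q(q,t)

    The algebra of symmetric functions is Q(q,t)[p_1, p_2, ...], the polynomial
    algebra on the power sums; the variable of index i stands for p_{i+1}. *)

Definition Sym : comAlgType Qqt := {malg Qqt[{cmonom nat}]}.

Definition psum (r : nat) : Sym := (<< 1 *g @ucm nat r.-1 >> : {malg Qqt[{cmonom nat}]}).

(* Substitution p_r := f r, with scalars mapped by g.  When f and g are the
   intended images this is exactly plethystic substitution. *)
Definition psubst (A : comNzRingType) (g : Qqt -> A) (f : nat -> A) (F : Sym) : A :=
  monalg.mmap g
    (fun mon : {cmonom nat} => \prod_(i <- finsupp mon) f i.+1 ^+ mon i) F.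

(* [:: e_0; ...; e_n], by Newton's identities
   n e_n = \sum_(1 <= r <= n) (-1)^(r-1) e_(n-r) p_r. *)
Fixpoint elems (n : nat) : seq Sym :=
  if n is n'.+1 then
    let s := elems n' in
    rcons s (n%:R^-1 *: \sum_(r < n) (-1) ^+ r * (s`_(n' - r) * psum r.+1))
  else [:: 1].

Definition elem (n : nat) : Sym := (elems n)`_n.

(* Image in N variables x_0, ..., x_{N-1}.  A symmetric function is determined
   by its images for all N. *)
Definition in_vars (N : nat) (F : Sym) : mpoly N Qqt :=
  psubst (fun c => c%:A) (fun r => \sum_(i < N) 'X_i ^+ r) F.

(** * The operators D_k and Q_{m,n} *)

(* F[X + M/z] as a polynomial in w = 1/z: since p_r[M/z] = (1-q^r)(1-t^r) z^-r,
   p_r is sent to p_r + (1-q^r)(1-t^r) w^r. *)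
Definition plethM (F : Sym) : {poly Sym} :=
  psubst (fun c => (c%:A)%:P)
    (fun r => (psum r)%:P + (((1 - q ^+ r) * (1 - t ^+ r))%:A)%:P * 'X^r) F.

(* Coefficient of z^k in F[X + M/z] \sum_i (-z)^i e_i: the term w^j of F[X + M/z]
   pairs with i = j + k. *)
Definition Dop (k : nat) (F : Sym) : Sym :=
  \sum_(j < size (plethM F)) (plethM F)`_j * ((-1) ^+ (j + k) * elem (j + k)).

(* (a,b) is an admissible lattice point of the m x n rectangle: off the diagonal,
   on the side d a - c b > 0 where (c,d) = (m-a,n-b), and closest to the diagonal
   among the lattice points of the rectangle off the diagonal (the distance of
   (x,y) is proportional to |n x - m y|).  The condition 0 < a < m keeps both
   columns a and c in the range where Q is defined; it excludes only points with
   a = 0 or c = 0.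
   The side matters: exchanging the roles of (a,b) and (c,d) multiplies
   Q_{m,n} by (-1)^(m-1).  For example [D_0, D_2](1) = - M (e_1^2 + (q+t) e_2),
   so with d a - c b > 0, Q_{2,2}(1) = [D_2, D_0](1) / M is Schur positive. *)
Definition is_split (m n : nat) (p : nat * nat) : Prop :=
  let: (a, b) := p in
  [/\ (0 < a < m)%N, (b <= n)%N, ((m - a) * b < (n - b) * a)%N &
      forall x y : nat, (x <= m)%N -> (y <= n)%N -> (n * x != m * y)%N ->
        (`|n * a - m * b| <= `|n * x - m * y|)%N].

(* A choice of an admissible point for every rectangle to be split. *)
Definition is_splitting (ch : nat -> nat -> nat * nat) : Prop :=
  forall m n : nat, (1 < m)%N -> (0 < n)%N -> is_split m n (ch m n).

Fixpoint Qrec (ch : nat -> nat -> nat * nat) (fuel m n : nat) : Sym -> Sym :=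
  if fuel is fuel'.+1 then
    if (m <= 1)%N then fun F => (-1) ^+ n * Dop n F
    else
      let: (a, b) := ch m n in
      let Qab := Qrec ch fuel' a b in
      let Qcd := Qrec ch fuel' (m - a) (n - b) in
      fun F => qtM^-1 *: (Qcd (Qab F) - Qab (Qcd F))
  else fun=> 0.

Definition Qop (ch : nat -> nat -> nat * nat) (m n : nat) : Sym -> Sym :=
  Qrec ch m m n.

Lemma Qop1 ch n F : Qop ch 1 n F = (-1) ^+ n * Dop n F.
Proof. by []. Qed.

Lemma is_split_gt0 m n a b : (0 < n)%N -> is_split m n (a, b) ->
  [/\ (0 < a < m)%N, (a <= 1)%N || (0 < b)%N & (m - a <= 1)%N || (0 < n - b)%N].
Proof.
move=> n0 [/andP[a0 am] bn side close]; split; first by rewrite a0.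
- case: (leqP a 1) => //= a1; case: b bn side close => [|//] _ _ close.
  have : (n * 1 != m * 0)%N by lia.
  by move/(close 1%N 0%N ltac:(lia) isT); nia.
- case: (leqP (m - a) 1) => //= _; case: (ltnP 0 (n - b)%N) => // e.
  by move: e; rewrite leqn0 => /eqP e; rewrite e mul0n ltn0 in side.
Qed.

Lemma Qrec_fuel ch fuel fuel' m n : is_splitting ch -> (0 < n)%N || (m <= 1)%N ->
  (0 < m <= fuel)%N -> (m <= fuel')%N -> Qrec ch fuel m n =1 Qrec ch fuel' m n.
Proof.
move=> chP; elim: fuel fuel' m n => [|f IH] [|f'] m n n0 /andP[m0 mf] mf' F.
- by lia.
- by lia.
- by lia.
cbn [Qrec]; case: (leqP m 1) n0 => [//|m1]; rewrite orbF => n0.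
have /= := @chP m n m1 n0; case: (ch m n) => a b /(is_split_gt0 n0).
move=> [/andP[a0 am] hb hd].
have EA := IH f' a b ltac:(by rewrite orbC) ltac:(lia) ltac:(lia).
have EB := IH f' (m - a)%N (n - b)%N ltac:(by rewrite orbC) ltac:(lia) ltac:(lia).
by rewrite !(EA, EB).
Qed.

Lemma QopE ch m n a b F : is_splitting ch -> (1 < m)%N -> (0 < n)%N ->
  ch m n = (a, b) ->
  Qop ch m n F = qtM^-1 *: (Qop ch (m - a) (n - b) (Qop ch a b F)
                            - Qop ch a b (Qop ch (m - a) (n - b) F)).
Proof.
case: m => [//|m] chP m1 n0 E.
have := chP m.+1 n m1 n0; rewrite E => /(is_split_gt0 n0) [/andP[a0 am] hb hd].
rewrite {1}/Qop; cbn [Qrec]; rewrite leqNgt m1 /= E.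
have EA := @Qrec_fuel ch m a a b chP ltac:(by rewrite orbC) ltac:(lia) ltac:(lia).
have EB := @Qrec_fuel ch m (m.+1 - a) (m.+1 - a) (n - b) chP
  ltac:(by rewrite orbC) ltac:(lia) ltac:(lia).
by rewrite /Qop !(EA, EB).
Qed.

Lemma splitting_exists : exists ch, is_splitting ch.
Proof.
exists (fun m n => egcdn n m) => m n m1 n0.
case: egcdnP => // a b; rewrite gcdnC; set g := gcdn m n => E blt.
have g0 : (0 < g)%N by rewrite gcdn_gt0 n0 orbT.
have /dvdnP[m' Em] : (g %| m)%N := dvdn_gcdl m n.
have /dvdnP[n' En] : (g %| n)%N := dvdn_gcdr m n.
have E' : (a * n' = b * m' + 1)%N.
  by apply/eqP; rewrite -(eqn_pmul2r g0) mulnDl -!mulnA -En -Em mul1n E.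
have bn : (b < n')%N by rewrite -(ltn_pmul2r g0) -En.
have m'0 : (0 < m')%N by case: (m') Em => [|//] Em; rewrite Em in m1.
have am : (a < m)%N.
  case: (ltnP 1 m') => [m'1|].
    have : (a * n' <= (n' - 1) * m' + 1)%N by rewrite E' leq_add2r leq_mul2r; lia.
    have : (m' <= m)%N by rewrite Em leq_pmulr.
    clearbody g; clear -m'1 bn; nia.
  rewrite leq_eqVlt ltnNge m'0 orbF => /eqP m'1.
  rewrite m'1 in E'; clearbody g; clear -E' bn m1; nia.
have eqg : (n * a = m * b + g)%N by rewrite mulnC E [(b * m)%N]mulnC.
split.
- by rewrite am andbT; case: (a) E' => //; rewrite mul0n addn1.
- by apply: ltnW; apply: (leq_trans bn); rewrite En leq_pmulr.
- rewrite !mulnBl eqg.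
  have : (a * b <= m * b)%N by rewrite leq_mul2r (ltnW am) orbT.
  have : (b * a <= n * a)%N.
    by rewrite leq_mul2r; apply/orP; right; apply: ltnW; apply: (leq_trans bn); rewrite En leq_pmulr.
  rewrite eqg [(b * a)%N]mulnC; clearbody g; clear -g0; lia.
- move=> x y _ _ ne.
  have -> : `|n * a - m * b|%N = g by rewrite eqg; clearbody g; lia.
  have dv : (g %| `|n * x - m * y|)%N.
    have : (g%:Z %| (n * x)%:Z - (m * y)%:Z)%Z.
      by rewrite rpredB // dvdzE /= dvdn_mulr // (dvdn_gcdl, dvdn_gcdr).
    by rewrite dvdzE.
  apply: dvdn_leq dv; rewrite absz_gt0 subr_eq0; exact: ne.
Qed.

(** * Rational parking functions *)

Section Parking.

Variables m n : nat.

(* The path is encoded by the abscissas of its north steps: u y is the abscissa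
   of the north step from height y to height y + 1.  These are < m because the
   path is weakly above y = (n/m) x, so that n (u y) <= m y < m n. *)
Definition dyck (u : {ffun 'I_n -> 'I_m}) : bool :=
  [forall y : 'I_n, (n * u y <= m * y)%N]
  && [forall y : 'I_n, forall y' : 'I_n, (y <= y')%N ==> (u y <= u y')%N].

(* The path passes through the lattice point (x,y) of the rectangle. *)
Definition passes (u : {ffun 'I_n -> 'I_m}) (x y : nat) : bool :=
  [forall z : 'I_n, if (z < y)%N then (u z <= x)%N else (x <= u z)%N].

(* A parking function is a pair (u, s) where s i is the height of the north step
   labelled by car i + 1 (cars are numbered from 1, ordinals from 0). *)
Definition PFtype : finType := ({ffun 'I_n -> 'I_m} * {perm 'I_n})%type.

Definition parking (pi : PFtype) : bool :=
  let: (u, s) := pi in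
  dyck u && [forall i : 'I_n, forall j : 'I_n,
    (u (s i) == u (s j)) && (s i < s j)%N ==> (i < j)%N].

(* No truncation occurs in m y - n x for a car of a parking function. *)
Definition rank (pi : PFtype) (i : 'I_n) : nat :=
  let y : nat := pi.2 i in
  let x : nat := pi.1 (pi.2 i) in
  (m * y - n * x + x * gcdn m n %/ m)%N.

(* The elements i of ides, in increasing order; car i is the ordinal a and car
   i + 1 is the ordinal b = a + 1, whose value is i. *)
Definition ides (pi : PFtype) : seq nat :=
  [seq val b | b : 'I_n <- enum 'I_n
             & [exists a : 'I_n, (a.+1 == b :> nat) && (rank pi a < rank pi b)%N]].

Definition pides (pi : PFtype) : seq nat :=
  pairmap (fun a b => (b - a)%N) 0%N (rcons (ides pi) n).

(* Cells are named by their lower-left corner (x, y).  The cell (x, y) lies below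
   the path when u y <= x, and fully above the diagonal when its lower-right
   corner (x + 1, y) does. *)
Definition area (u : {ffun 'I_n -> 'I_m}) : nat :=
  #|[set c : 'I_m * 'I_n | (u c.2 <= c.1)%N && (n * c.1.+1 <= m * c.2)%N]|.

Definition above (u : {ffun 'I_n -> 'I_m}) : {set 'I_m * 'I_n} :=
  [set c : 'I_m * 'I_n | (c.1 < u c.2)%N].

Definition arm (u : {ffun 'I_n -> 'I_m}) (c : 'I_m * 'I_n) : nat :=
  #|[set c' : 'I_m * 'I_n in above u | (c'.2 == c.2) && (c.1 < c'.1)%N]|.

Definition leg (u : {ffun 'I_n -> 'I_m}) (c : 'I_m * 'I_n) : nat :=
  #|[set c' : 'I_m * 'I_n in above u | (c'.1 == c.1) && (c'.2 < c.2)%N]|.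

(* The inequalities arm/(leg+1) <= m/n < (arm+1)/leg, cleared of denominators;
   with leg = 0 the second one holds, as it should. *)
Definition pdinv (u : {ffun 'I_n -> 'I_m}) : nat :=
  #|[set c : 'I_m * 'I_n in above u | (n * arm u c <= m * (leg u c).+1)%N
                        && (m * leg u c < n * (arm u c).+1)%N]|.

Definition tdinv (pi : PFtype) : nat :=
  #|[set ij : 'I_n * 'I_n | (ij.1 < ij.2)%N
      && (rank pi ij.1 < rank pi ij.2 < rank pi ij.1 + m)%N]|.

Definition maxdinv (u : {ffun 'I_n -> 'I_m}) : nat :=
  (\max_(pi : PFtype | parking pi && (pi.1 == u)) tdinv pi)%N.

Definition dinv (pi : PFtype) : int :=
  (tdinv pi)%:Z + (pdinv pi.1)%:Z - (maxdinv pi.1)%:Z.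

(* The least i in 1..gcd(m,n) such that the path passes through (i m_0, i n_0);
   i = gcd(m,n) always qualifies. *)
Definition ret (u : {ffun 'I_n -> 'I_m}) : nat :=
  let d := gcdn m n in
  (find (fun i => passes u (i.+1 * (m %/ d)) (i.+1 * (n %/ d))) (iota 0 d)).+1.

End Parking.

(** * Quasisymmetric and Schur functions in N variables *)

Section Variables_x.

Variable N : nat.

(* Gessel's F_alpha: sum of x_{w_1} ... x_{w_n} over w_1 <= ... <= w_n with
   w_i < w_{i+1} whenever i is a partial sum of alpha.  The position of the
   ordinal i is i + 1. *)
Definition fundamental (alpha : seq nat) : mpoly N Qqt :=
  \sum_(w : {ffun 'I_(sumn alpha) -> 'I_N} |
         [forall i : 'I_(sumn alpha), forall j : 'I_(sumn alpha),
            (i.+1 == j :> nat) ==>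
            (if i.+1 \in scanl addn 0%N alpha then (w i < w j)%N
             else (w i <= w j)%N)])
     \prod_i 'X_(w i).

Definition cell (la : seq nat) : finType :=
  {c : 'I_(size la) * 'I_(head 0%N la) | (c.2 < nth 0%N la c.1)%N}.

Definition semistandard (la : seq nat) (T : {ffun cell la -> 'I_N}) : bool :=
  [forall c : cell la, forall c' : cell la,
     (((val c).1 == (val c').1) && ((val c).2 < (val c').2)%N
        ==> (T c <= T c')%N)
     && (((val c).2 == (val c').2) && ((val c).1 < (val c').1)%N
        ==> (T c < T c')%N)].

Definition schur (la : seq nat) : mpoly N Qqt :=
  \sum_(T : {ffun cell la -> 'I_N} | semistandard T) \prod_c 'X_(T c).

Definition Hpoly (m n : nat) : mpoly N Qqt :=
  \sum_(pi : PFtype m n | parking pi)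
     ((\sum_(i < ret pi.1) t ^- i) * t ^+ area pi.1 * q ^ dinv pi)
       *: fundamental (pides pi).

End Variables_x.

(* Main.v *)
(* On the algebraic side Q_{2,2k} = [D_{k+1}, D_{k-1}] / M, and D_c(e_n) is read
   off the expansion of e_n[M] in h_j(q,t).  Since D_0 acts on degree 1 by 1 - M,
   Q_{m,1}(1) = e_1 and Q_{m,1}(e_1) = P^m(e_1^2) where P = ((1 - M) - D_0) / M has
   eigenvalues q and t on degree 2; hence Q_{2k,2}(1) = (P^{k-1} + P^k)(e_2).

   On the combinatorial side, the paths of the 2 x 2k rectangle are those with
   k + j north steps in the left column.  Standardization turns the sum over the
   parking functions of such a path into a sum over pairs of column-strict columns
   counted by inversions between cells of consecutive ranks.  Recording which
   letters occur in each column makes the sum a weighted walk, one letter (one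
   variable) at a time, whose generating function is a combination of products
   e_a e_b found by induction on the number of variables; the two-column Schur
   functions are sums over walks as well.  With g_j the normalized sum for the
   path j, this gives g_j = s_{2^{k-j} 1^{2j}} + q g_{j+1}, and summation by
   parts concludes. *)
From HB Require Import structures.
Require Import Defs.
From mathcomp Require Import all_boot all_order all_fingroup all_algebra fraction finmap.
From mathcomp Require Import zify ring.
From mathcomp Require Import monalg mpoly.

Set Implicit Arguments.
Unset Strict Implicit.
Unset Printing Implicit Defensive.

Import Order.TTheory GRing.Theory Num.Theory.

Local Open Scope ring_scope.

(** * Coefficients and plethystic substitution *)

Lemma mpolyX_neq0 (i : 'I_2) : ('X_i : mpoly 2 rat) != 0.
Proof.
apply/eqP => /(congr1 (fun p : mpoly 2 rat => p@_U_(i)))/eqP.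
by rewrite mcoeffX eqxx mcoeff0 oner_eq0.
Qed.

Lemma q_neq0 : q != 0.
Proof. by rewrite /q tofrac_eq0 mpolyX_neq0. Qed.

Lemma t_neq0 : t != 0.
Proof. by rewrite /t tofrac_eq0 mpolyX_neq0. Qed.

Lemma mpolyX_inj_ord (i j : 'I_2) : ('X_i : mpoly 2 rat) = 'X_j -> i = j.
Proof.
move/(congr1 (fun p : mpoly 2 rat => p@_U_(j))).
by rewrite !mcoeffX eqxx eq_mnm1; case: eqP.
Qed.

Lemma q_neq_t : q - t != 0.
Proof.
rewrite subr_eq0 /q /t tofrac_eq; apply/eqP => /mpolyX_inj_ord.
by move/(congr1 val).
Qed.

Lemma one_sub_tofracX_neq0 (i : 'I_2) : 1 - tofrac ('X_i : mpoly 2 rat) != 0 :> Qqt.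
Proof.
rewrite subr_eq0 -tofrac1 tofrac_eq; apply/eqP.
move/(congr1 (fun p : mpoly 2 rat => p@_0%MM)).
by rewrite mcoeff1 eqxx mcoeffX mnm1_eq0.
Qed.

Lemma qtM_neq0 : qtM != 0.
Proof. by rewrite mulf_neq0 // one_sub_tofracX_neq0. Qed.

Lemma natQqt_neq0 n : n.+1%:R != 0 :> Qqt.
Proof.
rewrite -[_%:R]/(1 *+ n.+1) -tofrac1 -tofracMn tofrac_eq0 -mpolyC1 -mpolyCMn.
by rewrite mpolyC_eq0 Num.Theory.pnatr_eq0.
Qed.

Section Psubst.

Variables (A : comNzRingType) (g : {rmorphism Qqt -> A}) (f : nat -> A).

Let h (mon : {cmonom nat}) : A := \prod_(i <- finsupp mon) f i.+1 ^+ mon i.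

Fact psubst_monom_morphism : mmorphism h.
Proof.
have hE (m : {cmonom nat}) (d : {fset nat}) : (finsupp m `<=` d)%fset ->
    h m = \prod_(i <- d) f i.+1 ^+ m i.
  move=> le; rewrite /h (big_fset_incl _ le) // => i _.
  by rewrite -cmE_eq0 => /eqP ->.
split=> [m1 m2|]; last by rewrite /h mdom1 big_seq_fset0.
set d := finsupp (mmul m1 m2); have Ed : d = _ := mdomD m1 m2.
have -> : h m1 = \prod_(i <- d) f i.+1 ^+ m1 i by apply: hE; rewrite Ed fsubsetUl.
have -> : h m2 = \prod_(i <- d) f i.+1 ^+ m2 i by apply: hE; rewrite Ed fsubsetUr.
by rewrite -big_split; apply: eq_bigr => i _; rewrite cmM exprD.
Qed.

HB.instance Definition _ := isMultiplicative.Build {cmonom nat} A h psubst_monom_morphism.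

Lemma psubstD : {morph psubst g f : F G / F + G}.
Proof. exact: (@monalg.mmapD _ _ _ g h). Qed.

Lemma psubst0 : psubst g f 0 = 0.
Proof. exact: (@monalg.mmap0 _ _ _ g h). Qed.

Lemma psubstM : {morph psubst g f : F G / F * G}.
Proof. exact: (@monalg.mmap_is_multiplicative _ _ A g h).1. Qed.

Lemma psubst1 : psubst g f 1 = 1.
Proof. exact: (@monalg.mmap1 _ _ A g h). Qed.

Lemma psubstZ c F : psubst g f (c *: F) = g c * psubst g f F.
Proof. exact: (@monalg.mmapZ _ _ A g h). Qed.

Lemma psubst_psum r : (0 < r)%N -> psubst g f (psum r) = f r.
Proof.
case: r => // r _; transitivity (g 1 * h (ucm r)).
  exact: (@monalg.mmapU _ _ _ g h).
by rewrite rmorph1 mul1r /h mdomU big_seq_fset1 cmUU expr1.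
Qed.

Lemma psubst_sum (I : Type) (s : seq I) (P : pred I) (F : I -> Defs.Sym) :
  psubst g f (\sum_(i <- s | P i) F i) = \sum_(i <- s | P i) psubst g f (F i).
Proof. exact: (big_morph _ psubstD psubst0). Qed.

End Psubst.

(* Unfolding these packed structures makes unification diverge. *)
#[global] Opaque Defs.Sym Qqt.

(** * Newton's identities *)

Definition conv (A : pzRingType) (E E' : nat -> A) (n : nat) : A :=
  \sum_(i < n.+1) E i * E' (n - i)%N.

Definition newton (A : pzRingType) (E P : nat -> A) : Prop :=
  E 0%N = 1 /\
  forall n, E n *+ n = \sum_(r < n) (-1) ^+ r * (E (n.-1 - r)%N * P r.+1).

Section Newton.

Variable A : comNzRingType.
Implicit Types E P : nat -> A.

Lemma eq_newton E E' P P' : E =1 E' -> (forall r, P r.+1 = P' r.+1) ->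
  newton E P -> newton E' P'.
Proof.
move=> eqE eqP [E0 En]; split=> [|n]; first by rewrite -eqE.
by rewrite -eqE En; apply: eq_bigr => r _; rewrite eqE eqP.
Qed.

Lemma newton_inj E E' P : (forall n (x : A), x *+ n.+1 = 0 -> x = 0) ->
  newton E P -> newton E' P -> E =1 E'.
Proof.
move=> tf [E0 En] [E'0 E'n]; apply: ltn_ind => -[_|n IH]; first by rewrite E0 E'0.
apply/eqP; rewrite -subr_eq0; apply/eqP/(tf n).
rewrite mulrnBl En E'n -sumrB big1 // => r _.
by rewrite IH ?subrr //= ltnS leq_subr.
Qed.

Lemma newtonM E E' P P' : newton E P -> newton E' P' ->
  newton (conv E E') (fun r => P r + P' r).
Proof.
move=> [E0 En] [E'0 E'n]; split=> [|n].
  by rewrite /conv big_ord1 E0 E'0 mulr1.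
have coefM_eq (a b c : {poly A}) : (forall m, (m <= n)%N -> a`_m = b`_m) ->
    (a * c)`_n = (b * c)`_n.
  by move=> ab; rewrite !coefM; apply: eq_bigr => j _; rewrite ab // -ltnS.
pose trunc (F : nat -> A) : {poly A} := \poly_(i < n.+1) F i.
pose sgnP (Q : nat -> A) i := if i is j.+1 then (-1) ^+ j * Q j.+1 else 0.
have truncE F m : (m <= n)%N -> (trunc F)`_m = F m.
  by move=> mn; rewrite coef_poly ltnS mn.
have mul_sgnP F (a : {poly A}) Q m : (m <= n)%N ->
    (forall i, (i <= n)%N -> a`_i = F i) ->
    (a * trunc (sgnP Q))`_m = \sum_(r < m) (-1) ^+ r * (F (m.-1 - r)%N * Q r.+1).
  case: m => [|m] mn aF.
    by rewrite coefM big_ord1 big_ord0 [X in _ * X]truncE // mulr0.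
  rewrite coefMr big_ord_recl truncE // mulr0 add0r; apply: eq_bigr => r _.
  rewrite truncE; last exact: leq_trans (ltn_ord r) _.
  rewrite aF lift0 subSS; first by rewrite /= mulrCA.
  exact: leq_trans (leq_subr _ _) (ltnW mn).
have derE F Q m : (m <= n)%N ->
    (forall k, F k *+ k = \sum_(r < k) (-1) ^+ r * (F (k.-1 - r)%N * Q r.+1)) ->
    ((trunc F)^`() * 'X)`_m = (trunc F * trunc (sgnP Q))`_m.
  move=> mn Fk; rewrite (mul_sgnP F) => [||i]; [|exact: mn|exact: truncE].
  by rewrite coefMX -Fk; case: m mn => [|m] mn; rewrite ?mulr0n //= coef_deriv truncE.
have convE m : (m <= n)%N -> (trunc E * trunc E')`_m = conv E E' m.
  move=> mn; rewrite coefM; apply: eq_bigr => i _; rewrite !truncE //.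
    exact: leq_trans (leq_subr _ _) mn.
  by apply: leq_trans mn; rewrite -ltnS.
rewrite -(mul_sgnP (conv E E') (trunc E * trunc E') (fun r => P r + P' r)) //.
transitivity (((trunc E * trunc E')^`() * 'X)`_n).
  case: (n) convE => [|m] convE; first by rewrite coefMX mulr0n.
  by rewrite coefMX /= coef_deriv convE.
have -> : (trunc E * trunc E')^`() * 'X =
    (trunc E)^`() * 'X * trunc E' + trunc E * ((trunc E')^`() * 'X).
  by rewrite derivM; ring.
rewrite coefD.
rewrite (coefM_eq _ (trunc E * trunc (sgnP P))) => [|m mn]; last exact: derE.
rewrite [X in _ + X]coefMr (eq_bigr (fun j : 'I_n.+1 =>
   (trunc E)`_(n - j) * (trunc E' * trunc (sgnP P'))`_j)); last first.
  by move=> j _; rewrite (derE _ P') // -ltnS.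
have -> : trunc (sgnP (fun r => P r + P' r)) = trunc (sgnP P) + trunc (sgnP P').
  apply/polyP => i; rewrite coefD !coef_poly; case: ifP => // _; rewrite ?addr0 //.
  by case: i => [|i]; rewrite /= ?addr0 // mulrDr.
by rewrite -coefMr -coefD; congr (nth 0 (polyseq _) _); ring.
Qed.

Lemma newton_line (x : A) :
  newton (fun n => if n is n'.+1 then (n' == 0)%:R * x else 1) (fun r => x ^+ r).
Proof.
split=> // -[|[|n]]; first by rewrite big_ord0 mulr0n.
  by rewrite big_ord1 /= mulr1n expr0 !mul1r.
rewrite !big_ord_recr /= big1 => [|[i lt_in] _].
  by rewrite subSn // !subnn eqxx /= !exprS; ring.
by rewrite /= subSn ?(ltnW lt_in) //= subn_eq0 leqNgt lt_in !mul0r mulr0.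
Qed.

Lemma newton_opp_line (x : A) : newton (fun n => (- x) ^+ n) (fun r => - x ^+ r).
Proof.
split=> // n; under eq_bigr => r _.
  have -> : (-1) ^+ r * ((- x) ^+ (n.-1 - r) * - x ^+ r.+1) = (- x) ^+ n.
    transitivity ((- x) ^+ (n.-1 - r + r.+1)).
      by rewrite exprD [in RHS](exprNn x r.+1) [(-1) ^+ r.+1]exprS; ring.
    by congr (_ ^+ _); case: n r => [[]|n] // [i lt_in]; rewrite addnS subnK.
  over.
by rewrite sumr_const card_ord.
Qed.

Fixpoint es (xs : seq A) (i : int) : A :=
  if xs is x :: s then es s i + x * es s (i - 1) else (i == 0)%:R.

Lemma es_lt0 xs i : i < 0 -> es xs i = 0.
Proof.
elim: xs i => [|x s IH] i i0 /=; first by case: eqP => // i1; lia.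
by rewrite !IH ?mulr0 ?addr0 //; lia.
Qed.

Lemma newton_es xs : newton (fun n => es xs n%:Z) (fun r => \sum_(x <- xs) x ^+ r).
Proof.
elim: xs => [|x s IH] /=.
  split=> // -[|n]; first by rewrite big_ord0 mulr0n.
  by rewrite mul0rn big1 // => r _; rewrite big_nil !mulr0.
apply: eq_newton (newtonM (newton_line x) IH) => [n|r]; last by rewrite big_cons.
rewrite /conv big_ord_recl mul1r subn0; congr (_ + _).
case: n => [|n]; first by rewrite big_ord0 es_lt0 ?mulr0.
rewrite big_ord_recl big1 => [|i _]; last by rewrite /= mul0r mul0r.
by rewrite /= mul1r addr0 subn1 /= intS addrC addKr.
Qed.

End Newton.

Lemma nth_elems n i : (i <= n)%N -> (elems n)`_i = elem i.
Proof.
have sz m : size (elems m) = m.+1.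
  by elim: m => //= m IH; rewrite size_rcons IH.
elim: n => [|n IH]; first by rewrite leqn0 => /eqP ->.
rewrite leq_eqVlt => /orP[/eqP -> //|]; rewrite ltnS => le_in.
by rewrite /= nth_rcons sz ltnS le_in IH.
Qed.

Lemma elemS n : elem n.+1 =
  n.+1%:R^-1 *: \sum_(r < n.+1) (-1) ^+ r * (elem (n - r) * psum r.+1).
Proof.
have sz : size (elems n) = n.+1 by elim: n => //= m IH; rewrite size_rcons IH.
have -> : elem n.+1 = (rcons (elems n) (n.+1%:R^-1 *:
    \sum_(r < n.+1) (-1) ^+ r * ((elems n)`_(n - r) * psum r.+1)))`_n.+1 by [].
rewrite nth_rcons sz ltnn eqxx; apply: congr1; apply: eq_bigr => r _.
by rewrite nth_elems // leq_subr.
Qed.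

Lemma newton_elem : newton elem psum.
Proof.
split=> // -[|n]; first by rewrite big_ord0 mulr0n.
rewrite elemS -scaler_nat scalerA mulfV ?scale1r //; exact: natQqt_neq0.
Qed.

Lemma lmod_torsion_free (V : lmodType Qqt) n (x : V) : x *+ n.+1 = 0 -> x = 0.
Proof.
rewrite -scaler_nat => /eqP; rewrite scaler_eq0 (negPf (natQqt_neq0 n)) /=.
by move/eqP.
Qed.

(** * The operators D_k *)

Section PlethysticM.

Variables (F : fieldType) (q t : F).

Definition hqt (n : nat) : F := (q ^+ n.+1 - t ^+ n.+1) / (q - t).

(* [elem_M n] is the plethystic e_n[(1 - q)(1 - t)]. *)
Definition elem_M (n : nat) : F :=
  if n is n'.+1 then (-1) ^+ n' * ((1 - q) * (1 - t) * hqt n') else 1.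

Lemma conv_line (x : F) (G : nat -> F) n :
  conv (fun n => if n is n'.+1 then (n' == 0)%:R * x else 1) G n.+1
  = G n.+1 + x * G n.
Proof.
rewrite /conv big_ord_recl mul1r subn0; congr (_ + _).
rewrite big_ord_recl big1 => [|i _]; last by rewrite /= mul0r mul0r.
by rewrite /= mul1r addr0 subn1.
Qed.

Hypothesis q_neq_t : q - t != 0.

Lemma newton_elem_M : newton elem_M (fun r => (1 - q ^+ r) * (1 - t ^+ r)).
Proof.
apply: eq_newton (newtonM (newton_line 1) (newtonM (newton_line (q * t))
  (newtonM (newton_opp_line q) (newton_opp_line t)))) => [n|r]; last first.
  by rewrite expr1n exprMn; ring.
have vE m : conv (fun n => (- q) ^+ n) (fun n => (- t) ^+ n) m = (-1) ^+ m * hqt m.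
  apply: (mulIf q_neq_t); rewrite -mulrA divfK // subrXX mulrCA mulrC.
  congr (_ * _); rewrite /conv big_distrr (reindex_inj rev_ord_inj) /=.
  apply: eq_bigr => i _; have le_im : (i <= m)%N by rewrite -ltnS.
  rewrite subSS subKn // [(- q) ^+ _]exprNn [(- t) ^+ _]exprNn.
  by rewrite mulrACA -exprD subnK.
case: n => [|n].
  by rewrite /conv big_ord1 mul1r big_ord1 mul1r big_ord1 mul1r.
rewrite conv_line; case: n => [|n].
  rewrite conv_line vE vE [conv _ _ 0]big_ord1 vE /= /hqt !exprS !expr0.
  by field.
by rewrite !conv_line !vE /= /hqt !exprS; field.
Qed.

End PlethysticM.

Lemma plethM_psubst F : plethM F = psubst (polyC \o in_alg Defs.Sym)
  (fun r => (psum r)%:P + (((1 - q ^+ r) * (1 - t ^+ r))%:A)%:P * 'X^r) F.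
Proof. by []. Qed.

Lemma plethM1 : plethM 1 = 1.
Proof. by rewrite plethM_psubst psubst1. Qed.

Lemma plethMD F G : plethM (F + G) = plethM F + plethM G.
Proof. by rewrite plethM_psubst psubstD. Qed.

Lemma plethMM F G : plethM (F * G) = plethM F * plethM G.
Proof. by rewrite plethM_psubst psubstM. Qed.

Lemma plethMZ c F : plethM (c *: F) = (c%:A)%:P * plethM F.
Proof. by rewrite plethM_psubst psubstZ. Qed.

Lemma newton_psubst (A : comNzRingType) (g : {rmorphism Qqt -> A}) f :
  newton (fun n => psubst g f (elem n)) f.
Proof.
case: newton_elem => _ En; split=> [|n]; first by rewrite psubst1.
have sgnE r : psubst g f ((-1) ^+ r) = (-1) ^+ r.
  elim: r => [|r IH]; first by rewrite psubst1.
  rewrite !exprS psubstM IH -scaleN1r psubstZ psubst1 mulr1.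
  by rewrite rmorphN1.
transitivity (psubst g f (elem n *+ n)).
  by elim: n {En} (n in elem n) => [|n IH] m; rewrite ?mulr0n ?psubst0 // !mulrSr psubstD IH.
rewrite En psubst_sum; apply: eq_bigr => r _.
by rewrite !psubstM sgnE psubst_psum.
Qed.

Lemma in_vars_elem N n : in_vars N (elem n) = es [seq 'X_i | i <- enum 'I_N] n%:Z.
Proof.
have vars : newton (fun n => in_vars N (elem n)) (fun r => \sum_(i < N) 'X_i ^+ r).
  exact: (newton_psubst (in_alg (mpoly N Qqt))).
apply: (newton_inj (@lmod_torsion_free (mpoly N Qqt)) vars
  (E' := fun n => es [seq 'X_i | i <- enum 'I_N] n%:Z)).
by apply: eq_newton (newton_es _) => // r; rewrite big_map big_enum.
Qed.

Definition mu (n : nat) : Qqt := elem_M q t n.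

Lemma plethM_elem n :
  plethM (elem n) = \poly_(j < n.+1) (mu j *: elem (n - j)).
Proof.
have pleth : newton (fun n => plethM (elem n))
   (fun r => (((1 - q ^+ r) * (1 - t ^+ r))%:A)%:P * 'X^r + (psum r)%:P).
  by apply: eq_newton (newton_psubst (polyC \o in_alg Defs.Sym) _) => // r; rewrite addrC.
have tf m (p : {poly Defs.Sym}) : p *+ m.+1 = 0 -> p = 0.
  move/polyP => p0; apply/polyP => i; rewrite coef0.
  by apply: (@lmod_torsion_free _ m); rewrite -coefMn p0 coef0.
apply: (newton_inj tf pleth (E' := fun n => \poly_(j < n.+1) (mu j *: elem (n - j)))).
pose phi : {rmorphism Qqt -> {poly Defs.Sym}} := polyC \o in_alg Defs.Sym.
have Nmu : newton (fun n => phi (mu n) * 'X^n)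
    (fun r => phi ((1 - q ^+ r) * (1 - t ^+ r)) * 'X^r).
  have [mu0 muS] := newton_elem_M q_neq_t; split=> [|m].
    by rewrite {1}/mu mu0 rmorph1 mul1r.
  rewrite -mulrnAl -rmorphMn {1}/mu muS rmorph_sum mulr_suml; apply: eq_bigr => r _.
  rewrite rmorphM rmorphXn rmorphN1 rmorphM -mulrA; congr (_ * _).
  rewrite mulrACA -exprD; congr (_ * 'X^_).
  by case: m r => [[]|m] // [r lt_r]; rewrite addnS subnK.
have Nelem : newton (fun n => (elem n)%:P) (fun r => (psum r)%:P).
  have [e0 eS] := newton_elem; split=> [|m]; first by rewrite e0.
  rewrite -polyCMn eS rmorph_sum; apply: eq_bigr => r _.
  by rewrite !rmorphM rmorphXn rmorphN1.
apply: eq_newton (newtonM Nmu Nelem) => [m|r //].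
rewrite poly_def; apply: eq_bigr => i _.
rewrite -mulrA -commr_polyXn mulrA -[phi _]/((mu i)%:A)%:P -polyCM.
by rewrite mulr_algl mul_polyC.
Qed.

Lemma DopE n k F : (size (plethM F) <= n)%N -> Dop k F =
  \sum_(j < n) (plethM F)`_j * ((-1) ^+ (j + k) * elem (j + k)).
Proof.
move=> szF; rewrite /Dop.
pose G j := (plethM F)`_j * ((-1) ^+ (j + k) * elem (j + k)).
rewrite -[LHS](big_mkord xpredT G) -[RHS](big_mkord xpredT G).
rewrite [RHS](big_cat_nat (leq0n _) szF) /= -[LHS]addr0; congr (_ + _).
rewrite big_nat_cond big1 // => j /andP[/andP[le_j _] _].
by rewrite /G nth_default ?mul0r.
Qed.

Lemma DopD k F G : Dop k (F + G) = Dop k F + Dop k G.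
Proof.
have leFG : (size (plethM (F + G))%R <= maxn (size (plethM F)) (size (plethM G)))%N.
  by rewrite plethMD; exact: size_polyD.
rewrite (DopE k leFG) (DopE k (leq_maxl (size (plethM F)) (size (plethM G)))).
rewrite (DopE k (leq_maxr (size (plethM F)) (size (plethM G)))) -big_split.
by apply: eq_bigr => j _; rewrite plethMD coefD mulrDl.
Qed.

Lemma DopZ k c F : Dop k (c *: F) = c *: Dop k F.
Proof.
have le_c : (size (plethM (c *: F)) <= size (plethM F))%N.
  by rewrite plethMZ mul_polyC; exact: size_scale_leq.
rewrite (DopE k le_c) /Dop scaler_sumr; apply: eq_bigr => j _.
by rewrite plethMZ coefCM -mulrA mulr_algl.
Qed.

Lemma Dop1 k : Dop k 1 = (-1) ^+ k * elem k.
Proof.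
have le1 : (size (plethM 1) <= 1)%N by rewrite plethM1 size_poly1.
by rewrite (DopE k le1) big_ord1 plethM1 coef1 mul1r.
Qed.

Lemma Dop_elem k n : Dop k (elem n) =
  \sum_(j < n.+1) mu j *: (elem (n - j) * ((-1) ^+ (j + k) * elem (j + k))).
Proof.
have le_n : (size (plethM (elem n)) <= n.+1)%N by rewrite plethM_elem size_poly.
rewrite (DopE k le_n); apply: eq_bigr => j _.
by rewrite plethM_elem coef_poly ltn_ord scalerAl.
Qed.

(** * Commutators of the operators *)

Definition qtH (F : fieldType) (q t : F) (n : nat) : F := (q ^+ n - t ^+ n) / (q - t).

Lemma qtH0 (F : fieldType) (q t : F) : qtH q t 0 = 0.
Proof. by rewrite /qtH subrr mul0r. Qed.

Lemma qtH1 (F : fieldType) (q t : F) : q - t != 0 -> qtH q t 1 = 1.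
Proof. by move=> qt; rewrite /qtH divff. Qed.

Lemma qtH2 (F : fieldType) (q t : F) : q - t != 0 -> qtH q t 2 = q + t.
Proof. by move=> qt; rewrite /qtH; field. Qed.

Lemma qtHSS (F : fieldType) (q t : F) n : q - t != 0 ->
  qtH q t n.+2 = (q + t) * qtH q t n.+1 - q * t * qtH q t n.
Proof. by move=> qt; rewrite /qtH !exprS; field. Qed.

Lemma split_2_2k k p : (0 < k)%N -> is_split 2 (2 * k) p -> p = (1%N, k.-1).
Proof.
case: p => a b k0 [/andP[a0 a2] bn side close].
have a1 : a = 1%N by lia.
subst a; congr (_, _).
have := close 1%N k.-1 isT ltac:(lia) ltac:(lia); lia.
Qed.

Lemma split_m_1 m p : (1 < m)%N -> is_split m 1 p -> p = (1%N, 0%N).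
Proof.
case: p => a b m1 [/andP[a0 am] bn side close].
have := close 1%N 0%N ltac:(lia) ltac:(lia) ltac:(lia).
by case: b bn side close => [|[|//]] _ side _ H; [congr (_, _); lia | exfalso; lia].
Qed.

Lemma split_odd_2 k p : is_split (2 * k + 3) 2 p -> p = (k.+2, 1%N).
Proof.
case: p => a b [/andP[a0 am] bn side close].
have := close k.+2 1%N ltac:(lia) ltac:(lia) ltac:(lia).
by case: b bn side close => [|[|[|//]]] _ side _ H; [exfalso; lia | congr (_, _); lia | exfalso; lia].
Qed.

Lemma split_2k_2 k p : is_split (2 * k + 4) 2 p -> p = (1%N, 0%N) \/ p = (k.+3, 1%N).
Proof.
case: p => a b [/andP[a0 am] bn side close].
have := close 1%N 0%N ltac:(lia) ltac:(lia) ltac:(lia).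
case: b bn side close => [|[|[|//]]] _ side _ H.
- by left; congr (_, _); lia.
- by right; congr (_, _); lia.
- by exfalso; lia.
Qed.

Lemma scale_comb2 (R : comNzRingType) (V : lmodType R) (m a b c d : R) (e f : V) :
  m *: ((a *: e + b *: f) - (c *: e + d *: f)) = (m * (a - c)) *: e + (m * (b - d)) *: f.
Proof. by rewrite opprD addrACA -!scalerBl scalerDr !scalerA. Qed.

Lemma elem_M1 (F : fieldType) (q t : F) : q - t != 0 ->
  elem_M q t 1 = (1 - q) * (1 - t).
Proof. by move=> qt; rewrite /elem_M expr0 mul1r [hqt _ _ _]qtH1 // mulr1. Qed.

Section OperatorCalculus.

Variables (F : fieldType) (q t : F) (V : comAlgType F) (e : nat -> V) (D : nat -> V -> V).
Let M := (1 - q) * (1 - t).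
Let H := qtH q t.

Hypotheses (q_neq_t : q - t != 0) (M_neq0 : M != 0).
Let HSS n : H n.+2 = (q + t) * H n.+1 - q * t * H n.
Proof. exact: qtHSS. Qed.
Let q1 : 1 - q != 0. Proof. by move: M_neq0; rewrite mulf_eq0 negb_or => /andP[]. Qed.
Let t1 : 1 - t != 0. Proof. by move: M_neq0; rewrite mulf_eq0 negb_or => /andP[]. Qed.
Hypothesis e0 : e 0 = 1.
Hypothesis DD : forall k, {morph D k : x y / x + y}.
Hypothesis DZ : forall k c, {morph D k : x / c *: x}.
Hypothesis D1 : forall k, D k 1 = (-1) ^+ k * e k.
Hypothesis De : forall k n, D k (e n) =
  \sum_(j < n.+1) elem_M q t j *: (e (n - j) * ((-1) ^+ (j + k) * e (j + k))).
Hypothesis D_sq : D 0 (e 1 ^+ 2) = (1 - M *+ 2) *: e 1 ^+ 2 + M ^+ 2 *: e 2.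

Let m1E : elem_M q t 1 = M.
Proof. exact: elem_M1. Qed.

Let m2E : elem_M q t 2 = - (M * (q + t)).
Proof. by rewrite /elem_M expr1 mulN1r -[hqt _ _ _]/(H 2) [H 2]qtH2. Qed.

Let D0_1 : D 0 1 = 1.
Proof. by rewrite D1 expr0 mul1r e0. Qed.

Let De1 k : D k (e 1) = e 1 * ((-1) ^+ k * e k) + M *: ((-1) ^+ k.+1 * e k.+1).
Proof.
transitivity (elem_M q t 0 *: (e 1 * ((-1) ^+ k * e k))
    + elem_M q t 1 *: (e 0 * ((-1) ^+ k.+1 * e k.+1))).
  by rewrite De !big_ord_recl big_ord0 addr0.
by rewrite m1E e0 scale1r mul1r.
Qed.

Let D0_e1 : D 0 (e 1) = (1 - M) *: e 1.
Proof.
by rewrite De1 e0 expr0 expr1 mul1r mulr1 mulN1r scalerN scalerBl scale1r.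
Qed.

Let D1_e1 : D 1 (e 1) = - e 1 ^+ 2 + M *: e 2.
Proof. by rewrite De1 expr1 mulN1r mulrN -expr2 sqrrN expr1n mul1r. Qed.

Let D0_e2 : D 0 (e 2) = - M *: e 1 ^+ 2 + (1 - M * (q + t)) *: e 2.
Proof.
transitivity (elem_M q t 0 *: (e 2 * ((-1) ^+ 0 * e 0))
    + (elem_M q t 1 *: (e 1 * ((-1) ^+ 1 * e 1))
       + elem_M q t 2 *: (e 0 * ((-1) ^+ 2 * e 2)))).
  by rewrite De !big_ord_recl big_ord0 addr0.
rewrite m1E m2E e0 scale1r expr0 expr1 mulN1r mulrN -expr2 !mul1r mulr1.
rewrite sqrrN expr1n mul1r scalerN !scaleNr scalerBl scale1r.
by rewrite addrCA.
Qed.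

Let D0_comb a b : D 0 (a *: e 1 ^+ 2 + b *: e 2) =
  (a * (1 - M *+ 2) - b * M) *: e 1 ^+ 2 + (a * M ^+ 2 + b * (1 - M * (q + t))) *: e 2.
Proof.
by rewrite DD !DZ D_sq D0_e2 !scalerDr !scalerA addrACA -!scalerDl mulrN.
Qed.

Let sq_comb (a b : F) : a *: (e 1 ^+ 2 - e 2) + b *: e 2 = a *: e 1 ^+ 2 + (b - a) *: e 2.
Proof. by rewrite scalerBr scalerBl -addrA [- _ + _]addrC. Qed.

Let Q2_value k := (H k.+1 + H k) *: (e 1 ^+ 2 - e 2) + (H k.+2 + H k.+1) *: e 2.

Lemma slope_2_2 : M^-1 *: (D 2 (D 0 1) - D 0 (D 2 1)) = Q2_value 0.
Proof.
rewrite D0_1 D1 sqrrN expr1n mul1r D0_e2 -[e 2 in X in X - _]scale1r.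
rewrite -[1 *: e 2]add0r -[0 in X in X - _](scale0r (e 1 ^+ 2)) scale_comb2.
rewrite /Q2_value sq_comb /H qtH1 // qtH0 qtH2 //.
by congr (_ *: _ + _ *: _); rewrite /M; field; rewrite ?q1 ?t1.
Qed.

Section Slope.

Variable X : nat -> V -> V.
Hypothesis X1 : forall x, X 1 x = - D 1 x.
Hypothesis XS : forall m x, X m.+2 x = M^-1 *: (X m.+1 (D 0 x) - D 0 (X m.+1 x)).
Let XZ m c x : X m.+1 (c *: x) = c *: X m.+1 x.
Proof.
elim: m x => [|m IH] x; first by rewrite !X1 DZ scalerN.
by rewrite !XS DZ !IH DZ -scalerBr !scalerA mulrC.
Qed.

Let X_1 m : X m.+1 1 = e 1.
Proof.
elim: m => [|m IH]; first by rewrite X1 D1 expr1 mulN1r opprK.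
by rewrite XS D0_1 IH D0_e1 scalerBl scale1r subKr scalerA mulVf // scale1r.
Qed.

Let X_e1 m : X m.+1 (e 1) =
  (H m.+1 - q * t * H m) *: e 1 ^+ 2 + (- M * H m.+1) *: e 2.
Proof.
elim: m => [|m IH].
  rewrite X1 D1_e1 /H qtH1 // qtH0 mulr0 subr0 scale1r mulr1 opprD opprK.
  by rewrite scaleNr.
rewrite XS D0_e1 XZ IH D0_comb [(1 - M) *: (_ + _)]scalerDr !scalerA scale_comb2 [H m.+2]HSS.
by congr (_ *: _ + _ *: _); rewrite /M; field; rewrite ?q1 ?t1.
Qed.

Lemma slope_commutator k :
  M^-1 *: (X k.+1 (X k.+3 1) - X k.+3 (X k.+1 1)) = Q2_value k.+1.
Proof.
rewrite !X_1 !X_e1 scale_comb2 /Q2_value sq_comb [H k.+3]HSS !HSS.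
by congr (_ *: _ + _ *: _); rewrite /M; field; rewrite ?q1 ?t1.
Qed.

Lemma slope_nested_commutator k (Y : V -> V) :
  (forall x, Y x = M^-1 *: (X k.+1 (X k.+2 x) - X k.+2 (X k.+1 x))) ->
  M^-1 *: (Y (D 0 1) - D 0 (Y 1)) = Q2_value k.+1.
Proof.
move=> YE; rewrite D0_1 YE !X_1 !X_e1 scale_comb2 D0_comb scale_comb2.
rewrite /Q2_value sq_comb [H k.+3]HSS !HSS.
by congr (_ *: _ + _ *: _); rewrite /M; field; rewrite ?q1 ?t1.
Qed.

End Slope.

Section Columns.

Variable k : nat.

Let T j := if (j <= k)%N then e (k + j) * e (k - j) else 0.

Let N j : F := (-1) ^+ j * elem_M q t j.

Let signZ n (x : V) : (-1) ^+ n * x = (-1) ^+ n *: x.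
Proof. by rewrite -mulr_algl -[(_ *: 1)]/(in_alg V _) rmorphXn rmorphN1. Qed.

Let D_e c n : (-1) ^+ c * D c (e n) = \sum_(j < n.+1) N j *: (e (n - j) * e (c + j)).
Proof.
rewrite De big_distrr; apply: eq_bigr => j _ /=.
rewrite !signZ -scalerAr !scalerA addnC exprD; congr (_ *: _).
by rewrite mulrACA -expr2 sqrr_sign mul1r mulrC.
Qed.

Let D_1 c : (-1) ^+ c * D c 1 = e c.
Proof. by rewrite D1 mulrA -expr2 sqrr_sign mul1r. Qed.

Let N0 : N 0 = 1. Proof. by rewrite /N expr0 mul1r. Qed.

Let NS j : N j.+1 = - (M * H j.+1).
Proof.
by rewrite /N /= exprS mulN1r mulNr !mulrA -expr2 sqrr_sign mul1r.
Qed.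

Lemma column_commutator : (0 < k)%N ->
  M^-1 *: ((-1) ^+ k.+1 * D k.+1 ((-1) ^+ k.-1 * D k.-1 1)
           - (-1) ^+ k.-1 * D k.-1 ((-1) ^+ k.+1 * D k.+1 1))
  = \sum_(j < k.+1) (H j.+1 + H j) *: (T j - T j.+1).
Proof.
move=> k_gt0; rewrite !D_1 !D_e (prednK k_gt0).
have T_out : T k.+1 = 0 by rewrite /T ltnn.
have H0 : H 0 = 0 by rewrite /H qtH0.
have -> : \sum_(j < k) N j *: (e (k.-1 - j) * e (k.+1 + j))
    = T 1 - M *: \sum_(j < k.+1) H j *: T j.+1.
  transitivity (\sum_(j < k) N j *: T j.+1).
    apply: eq_bigr => j _; rewrite /T ltn_ord mulrC -subn1 -subnDA add1n.
    by rewrite addSnnS.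
  rewrite big_ord_recr /= T_out scaler0 addr0; move: (T) k_gt0 => T'.
  case: (k) => // k' _; rewrite !big_ord_recl /= H0 N0 scale0r add0r scale1r.
  congr (_ + _); rewrite scaler_sumr -sumrN; apply: eq_bigr => j _.
  by rewrite /bump add1n NS scalerA scaleNr.
have -> : \sum_(j < k.+2) N j *: (e (k.+1 - j) * e (k.-1 + j))
    = T 1 - M *: \sum_(j < k.+1) H j.+1 *: T j.
  rewrite big_ord_recl N0 scale1r /T k_gt0 subn0 addn0 subn1 addn1.
  rewrite scaler_sumr -sumrN; apply: congr2 => //; apply: eq_bigr => j _.
  have -> : (j <= k)%N by rewrite -ltnS.
  rewrite lift0 NS scalerA scaleNr subSS addnS -addSn (prednK k_gt0).
  by rewrite [e (k - j) * _]mulrC.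
rewrite opprB addrC addrA subrK -scalerBr scalerA mulVf // scale1r.
apply/eqP; rewrite -subr_eq0; apply/eqP.
pose f j := H j *: T j.
transitivity (\sum_(0 <= j < k.+1) (f j.+1 - f j)).
  rewrite big_mkord -!sumrN -!big_split; apply: eq_bigr => j _; rewrite /f /=.
  by rewrite scalerDl !scalerBr; ring.
by rewrite telescope_sumr // /f T_out H0 scaler0 scale0r subr0.
Qed.

End Columns.

End OperatorCalculus.

Lemma coef_sq_line (A : comNzRingType) (p : {poly A}) : (size p <= 2)%N ->
  [/\ (size (p * p)%R <= 3)%N, (p * p)`_0 = p`_0 ^+ 2,
      (p * p)`_1 = p`_0 * p`_1 *+ 2 & (p * p)`_2 = p`_1 ^+ 2].
Proof.
move=> sp; have p2 : p`_2 = 0 by rewrite nth_default.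
split.
- by apply: leq_trans (size_polyMleq _ _) _; move: (size p) sp; case=> [|[|[|]]].
- by rewrite coefM big_ord1.
- by rewrite coefM !big_ord_recl big_ord0 addr0 /= mulr2n [p`_(bump _ _) * _]mulrC.
- rewrite coefM !big_ord_recl big_ord0 addr0 /= [_`_(2 - 0)]p2 mulr0 add0r.
  by rewrite mul0r addr0 expr2.
Qed.

Lemma sum_elem_sq (R : comNzRingType) (V : comAlgType R) (M : R) (e c : nat -> V) :
  e 0 = 1 -> c 0 = e 1 ^+ 2 -> c 1 = e 1 * M%:A *+ 2 -> c 2 = M%:A ^+ 2 ->
  \sum_(j < 3) c j * ((-1) ^+ (j + 0) * e (j + 0)%N)
    = (1 - M *+ 2) *: e 1 ^+ 2 + M ^+ 2 *: e 2.
Proof.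
move=> e0 c0 c1 c2; rewrite !big_ord_recr big_ord0 /= !addn0 c0 c1 c2 e0.
rewrite add0r expr0 expr1 mulr1 mulr1 sqrrN expr1n mul1r mulN1r.
rewrite scalerBl scale1r mulrN mulrnAl mulrAC mulr_algr -scalerMnl -expr2.
by rewrite [M%:A ^+ 2]expr2 mulr_algr scalerA -expr2 mulr_algl.
Qed.

Lemma elem0 : elem 0 = 1.
Proof. by []. Qed.

Lemma Dop0_elem1_sq :
  Dop 0 (elem 1 ^+ 2) = (1 - qtM *+ 2) *: elem 1 ^+ 2 + qtM ^+ 2 *: elem 2.
Proof.
have coefE j : (j <= 1)%N -> (plethM (elem 1))`_j = mu j *: elem (1 - j).
  by move=> le_j; rewrite plethM_elem coef_poly ltnS le_j.
have c0 : (plethM (elem 1))`_0 = elem 1.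
  exact: etrans (coefE 0%N isT) (scale1r _).
have c1 : (plethM (elem 1))`_1 = qtM%:A.
  have mu1 : mu 1 = qtM := elem_M1 q_neq_t.
  move: (coefE 1%N isT) mu1 elem0; rewrite subnn.
  move: (plethM _)`_1 (mu 1) (elem 0) qtM => c m x M'.
  move=> -> -> ->; reflexivity.
have sz : (size (plethM (elem 1)) <= 2)%N by rewrite plethM_elem size_poly.
have [sz3 C0 C1 C2] := coef_sq_line sz.
rewrite -plethMM -expr2 in sz3 C0 C1 C2.
rewrite (DopE 0 sz3); apply: (sum_elem_sq elem0).
- rewrite C0 c0; reflexivity.
- rewrite C1 c0 c1; reflexivity.
- rewrite C2 c1; reflexivity.
Qed.

(** * Values of Q_{2,2k} and Q_{2k,2} at 1 *)

Section QValues.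

Variable split : nat -> nat -> nat * nat.
Hypothesis splitP : is_splitting split.

Lemma Qop_2_2k k : (0 < k)%N -> Qop split 2 (2 * k) 1 =
  \sum_(j < k.+1) (qtH q t j.+1 + qtH q t j) *:
     ((if (j <= k)%N then elem (k + j) * elem (k - j) else 0)
      - (if (j.+1 <= k)%N then elem (k + j.+1) * elem (k - j.+1) else 0)).
Proof.
move=> k_gt0; have n_gt0 : (0 < 2 * k)%N by rewrite muln_gt0.
have splitE := split_2_2k k_gt0 (@splitP 2 (2 * k) isT n_gt0).
rewrite (@QopE split 2 (2 * k) _ _ 1 splitP isT n_gt0 splitE).
have -> : (2 * k - k.-1 = k.+1)%N by lia.
rewrite (erefl : (2 - 1 = 1)%N) !Qop1.
exact: (column_commutator qtM_neq0 Dop1 Dop_elem k_gt0).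
Qed.

Lemma Qop_1_1 F : Qop split 1 1 F = - Dop 1 F.
Proof. by rewrite Qop1 expr1 mulN1r. Qed.

Lemma Qop_1_0 F : Qop split 1 0 F = Dop 0 F.
Proof. by rewrite Qop1 expr0 mul1r. Qed.

Lemma Qop_1_2 F : Qop split 1 2 F = Dop 2 F.
Proof. by rewrite Qop1 sqrrN expr1n mul1r. Qed.

#[local] Opaque Qop Dop.

Lemma Qop_m_1 m F : Qop split m.+2 1 F =
  qtM^-1 *: (Qop split m.+1 1 (Dop 0 F) - Dop 0 (Qop split m.+1 1 F)).
Proof.
have splitE := @split_m_1 m.+2 _ isT (@splitP m.+2 1 isT isT).
rewrite (@QopE split m.+2 1 _ _ F splitP isT isT splitE) subn0 subSS subn0.
by rewrite !Qop_1_0.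
Qed.

Lemma Qop_2k_2 k : Qop split (2 * k.+1) 2 1 =
  (qtH q t k.+1 + qtH q t k) *: (elem 1 ^+ 2 - elem 2)
  + (qtH q t k.+2 + qtH q t k.+1) *: elem 2.
Proof.
have m_gt1 : (1 < 2 * k.+1)%N by lia.
case: k m_gt1 => [|k] m_gt1.
  have splitE := split_2_2k (isT : (0 < 1)%N) (@splitP 2 2 isT isT).
  rewrite (@QopE split (2 * 1) 2 _ _ 1 splitP m_gt1 isT splitE) (erefl : (2 * 1 - 1 = 1)%N) (erefl : (2 - 1.-1 = 2)%N).
  rewrite !Qop_1_0 !Qop_1_2.
  exact: (slope_2_2 q_neq_t qtM_neq0 elem0 Dop1 Dop_elem).
have mE : (2 * k.+2 = 2 * k + 4)%N by lia.
have sp : is_split (2 * k + 4) 2 (split (2 * k.+2) 2).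
  by rewrite -mE; exact: splitP.
have [splitE|splitE] := split_2k_2 sp.
  rewrite (@QopE split (2 * k.+2) 2 _ _ 1 splitP m_gt1 isT splitE) !Qop_1_0 subn0.
  have -> : (2 * k.+2 - 1 = 2 * k + 3)%N by lia.
  have YE F : Qop split (2 * k + 3) 2 F =
    qtM^-1 *: (Qop split k.+1 1 (Qop split k.+2 1 F)
               - Qop split k.+2 1 (Qop split k.+1 1 F)).
    have o_gt1 : (1 < 2 * k + 3)%N by lia.
    have splitE' := split_odd_2 (@splitP (2 * k + 3) 2 o_gt1 isT).
    rewrite (@QopE split (2 * k + 3) 2 _ _ F splitP o_gt1 isT splitE').
    have -> : (2 * k + 3 - k.+2 = k.+1)%N by lia.
    reflexivity.
  exact: (@slope_nested_commutator Qqt q t Defs.Sym elem Dop q_neq_t qtM_neq0 elem0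
    DopD DopZ Dop1 Dop_elem Dop0_elem1_sq (fun m => Qop split m 1) Qop_1_1 Qop_m_1 k
    (Qop split (2 * k + 3) 2) YE).
rewrite (@QopE split (2 * k.+2) 2 _ _ 1 splitP m_gt1 isT splitE).
have -> : (2 * k.+2 - k.+3 = k.+1)%N by lia.
exact: (@slope_commutator Qqt q t Defs.Sym elem Dop q_neq_t qtM_neq0 elem0
  DopD DopZ Dop1 Dop_elem Dop0_elem1_sq (fun m => Qop split m 1) Qop_1_1 Qop_m_1 k).
Qed.

End QValues.

(** * Weighted walks *)

Section Walk.

Variables (F : fieldType) (V : comAlgType F).
Implicit Types (xs : seq V) (D a b : int).

Fixpoint walk (wA wB wAB : int -> F) xs D a b : V :=
  if xs is x :: s then
    walk wA wB wAB s D a b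
    + x * (wA D *: walk wA wB wAB s (D + 1) (a - 1) b
           + wB D *: walk wA wB wAB s (D - 1) a (b - 1))
    + x ^+ 2 * (wAB D *: walk wA wB wAB s D (a - 1) (b - 1))
  else ((a == 0) && (b == 0))%:R.

Lemma eq_walk wA wB wAB wA' wB' wAB' xs D a b :
  wA =1 wA' -> wB =1 wB' -> wAB =1 wAB' ->
  walk wA wB wAB xs D a b = walk wA' wB' wAB' xs D a b.
Proof.
move=> EA EB EAB; elim: xs D a b => //= x s IH D a b.
by rewrite !IH EA EB EAB.
Qed.

Lemma walk_swap wA wB wAB xs D a b : walk wA wB wAB xs D a b =
  walk (fun D => wB (1 - D)) (fun D => wA (1 - D)) (fun D => wAB (1 - D))
       xs (1 - D) b a.
Proof.
elim: xs D a b => [|x s IH] D a b /=; first by rewrite andbC.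
rewrite !IH !subKr [in LHS](addrC (wA D *: _)); congr (_ + x * (_ *: _ + _ *: _) + _).
- by congr walk; lia.
- by congr walk; lia.
Qed.

Definition ee xs (a b : int) : V := es xs a * es xs b.

Lemma ee_cons x s a b : ee (x :: s) a b =
  ee s a b + x * (ee s (a - 1) b + ee s a (b - 1)) + x ^+ 2 * ee s (a - 1) (b - 1).
Proof. by rewrite /ee /=; ring. Qed.

Lemma ee_nil a b : ee [::] a b = ((a == 0) && (b == 0))%:R.
Proof. by rewrite /ee /= -natrM mulnb. Qed.

Definition tableau_walk : seq V -> int -> int -> int -> V :=
  walk (fun=> 1) (fun D => (0 < D)%R%:R) (fun D => (0 <= D)%R%:R).

Lemma tableau_walkE xs D a b : 0 <= D -> b <= D + a ->
  tableau_walk xs D a b = ee xs a b - ee xs (a + D + 1) (b - D - 1).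
Proof.
elim: xs D a b => [|x s IH] D a b D0 Db.
  by rewrite !ee_nil [in X in _ - X](_ : _ && _ = false) ?subr0 //; lia.
have -> : tableau_walk (x :: s) D a b = tableau_walk s D a b
   + x * (tableau_walk s (D + 1) (a - 1) b
          + (0 < D)%R%:R *: tableau_walk s (D - 1) a (b - 1))
   + x ^+ 2 * tableau_walk s D (a - 1) (b - 1).
  by rewrite /tableau_walk /= D0 !scale1r.
rewrite [tableau_walk s (D + 1) _ _]IH; [|lia|lia].
rewrite [tableau_walk s D _ _]IH; [|lia|lia].
rewrite [tableau_walk s D _ _]IH; [|lia|lia].
have -> : (0 < D)%R%:R *: tableau_walk s (D - 1) a (b - 1)
    = ee s a (b - 1) - ee s (a + D) (b - D - 1).
  have [D_gt0|] := ltP 0 D.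
    rewrite scale1r IH; [|lia|lia]; congr (_ - ee _ _ _); lia.
  move=> D_le0; have -> : D = 0 by lia.
  by rewrite scale0r subr0 addr0 subrr.
have -> : a - 1 + (D + 1) + 1 = a + D + 1 by lia.
have -> : b - (D + 1) - 1 = b - D - 1 - 1 by lia.
have -> : a - 1 + D + 1 = a + D + 1 - 1 by lia.
have -> : b - 1 - D - 1 = b - D - 1 - 1 by lia.
rewrite !ee_cons; have -> : a + D + 1 - 1 = a + D by lia.
by ring.
Qed.

Variable q : F.
Hypothesis q_neq0 : q != 0.

Definition llt_walk : seq V -> int -> int -> int -> V :=
  walk (fun D => if D <= 0 then q else 1) (fun D => if 0 < D then q else 1) (fun=> q).

Lemma llt_walk_swap xs D a b : llt_walk xs D a b = llt_walk xs (1 - D) b a.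
Proof.
rewrite /llt_walk walk_swap; apply: eq_walk => // D'.
  by have -> : (0 < 1 - D') = (D' <= 0) by lia.
by have -> : (1 - D' <= 0) = (0 < D') by lia.
Qed.

Section ClosedForm.

Variable L : nat.

Definition ee_sum xs (c m n : int) : V :=
  \sum_(i < L) q ^ (c + i%:Z) *: ee xs (m + i%:Z) (n - i%:Z).

Definition llt_ee xs (D a b : int) : V :=
  q ^ b *: ee xs a b + (q - 1) *: ee_sum xs b (a + D) (b - D).

Lemma ee_sum_cons x s c m n : ee_sum (x :: s) c m n =
  ee_sum s c m n + x * (ee_sum s c (m - 1) n + ee_sum s c m (n - 1))
  + x ^+ 2 * ee_sum s c (m - 1) (n - 1).
Proof.
rewrite /ee_sum mulrDr !mulr_sumr -!big_split; apply: eq_bigr => i _ /=.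
rewrite ee_cons !scalerDr !scalerAr scalerDr mulrDr.
by rewrite /ee !scalerAr (addrAC m (-1)) (addrAC n (-1)).
Qed.

Lemma ee_sumS xs c m n : n < L%:Z ->
  ee_sum xs c m n = q ^ c *: ee xs m n + ee_sum xs (c + 1) (m + 1) (n - 1).
Proof.
move=> n_lt; pose f i := q ^ (c + i%:Z) *: ee xs (m + i%:Z) (n - i%:Z).
have fL : f L = 0 by rewrite /f /ee [es _ (n - _)]es_lt0 ?mulr0 ?scaler0 //; lia.
transitivity (\sum_(i < L.+1) f i); first by rewrite big_ord_recr /= fL addr0.
rewrite big_ord_recl; congr (_ + _); first by rewrite /f /= !addr0.
apply: eq_bigr => i _.
have -> : c + 1 + i%:Z = c + (lift ord0 i)%:Z by rewrite lift0; lia.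
have -> : m + 1 + i%:Z = m + (lift ord0 i)%:Z by rewrite lift0; lia.
by have -> : n - 1 - i%:Z = n - (lift ord0 i)%:Z by rewrite lift0; lia.
Qed.

Lemma ee_sumXZ xs d c m n : q ^ d *: ee_sum xs c m n = ee_sum xs (d + c) m n.
Proof.
rewrite scaler_sumr; apply: eq_bigr => i _.
by rewrite scalerA -expfzDr // addrA.
Qed.

Lemma ee_sumZ xs c m n : q *: ee_sum xs c m n = ee_sum xs (c + 1) m n.
Proof. by rewrite addrC -ee_sumXZ expr1z. Qed.

Lemma llt_walkE xs D a b : b < D + a -> b <= L%:Z ->
  llt_walk xs D a b =
  if 0 < D then llt_ee xs D a b else q ^ (1 - D) *: llt_ee xs 1 a b.
Proof.
have qb n : q * q ^ n = q ^ (n + 1).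
  by rewrite -{1}[q]expr1z -expfzDr // addrC.
have qZ s c X m n : q *: (q ^ (c - 1) *: X + (q - 1) *: ee_sum s (c - 1) m n)
    = q ^ c *: X + (q - 1) *: ee_sum s c m n.
  by rewrite scalerDr !scalerA qb subrK (mulrC q (q - 1)) -scalerA ee_sumZ subrK.
elim: xs D a b => [|x s IH] D a b Db bL.
  have ee_sum0 m n : 0 < D /\ m = a + D /\ n = b - D
      \/ D <= 0 /\ m = a + 1 /\ n = b - 1 -> ee_sum [::] b m n = 0.
    by move=> Hmn; apply: big1 => i _; rewrite ee_nil (_ : _ && _ = false) ?scaler0 //; lia.
  rewrite /llt_walk /= /llt_ee !ee_nil; case: (ltP 0 D) => D0.
    rewrite ee_sum0 ?scaler0 ?addr0; last by left; lia.
    case: (a =P 0) => [_|_] /=; last by rewrite scaler0.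
    by case: (b =P 0) => [->|_]; rewrite ?scaler0 // expr0z scale1r.
  rewrite ee_sum0 ?scaler0 ?addr0; last by right; lia.
  have -> : (a == 0) && (b == 0) = false by lia.
  by rewrite !scaler0.
have step e : llt_ee (x :: s) e a b = llt_ee s e a b
   + x * (q ^ b *: (ee s (a - 1) b + ee s a (b - 1))
          + (q - 1) *: (ee_sum s b (a + e - 1) (b - e) + ee_sum s b (a + e) (b - e - 1)))
   + x ^+ 2 * (q *: llt_ee s e (a - 1) (b - 1)).
  rewrite /llt_ee ee_cons ee_sum_cons.
  have comb (c d : F) (y E0 E1 E2 U0 U1 U2 : V) :
    c *: (E0 + x * E1 + y * E2) + d *: (U0 + x * U1 + y * U2)
    = (c *: E0 + d *: U0) + x * (c *: E1 + d *: U1) + y * (c *: E2 + d *: U2).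
    by rewrite !scalerDr !scalerAr; ring.
  rewrite {}comb (addrAC a (-1)) (addrAC b (-1)); congr (_ + _ * _).
  by rewrite qZ.
have -> : llt_walk (x :: s) D a b = llt_walk s D a b
   + x * ((if D <= 0 then q else 1) *: llt_walk s (D + 1) (a - 1) b
          + (if 0 < D then q else 1) *: llt_walk s (D - 1) a (b - 1))
   + x ^+ 2 * (q *: llt_walk s D (a - 1) (b - 1)) by [].
rewrite !IH; try lia.
rewrite !step; case: (ltP 0 D) => [D_gt0|D_le0].
  have -> : (0 < D + 1) = true by lia.
  congr (_ + _ * _ + _); rewrite scale1r {1}/llt_ee.
  have -> : a - 1 + (D + 1) = a + D by lia.
  have -> : b - (D + 1) = b - D - 1 by lia.
  case: (ltP 0 (D - 1)) => D1.
    rewrite /llt_ee qZ.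
    have -> : a + (D - 1) = a + D - 1 by lia.
    have -> : b - 1 - (D - 1) = b - D by lia.
    rewrite addrACA -!scalerDr; congr (_ + _ *: _); exact: addrC.
  have -> : D = 1 by lia.
  rewrite subrr subr0 expr1z /llt_ee qZ addrK [ee_sum s b a (b - 1)]ee_sumS; last by lia.
  rewrite -(ee_sumZ s b (a + 1)) !scalerDr !scalerA.
  have -> : q * q ^ b = q ^ b + (q - 1) * q ^ b by ring.
  by rewrite (mulrC q (q - 1)) [(q ^ b + _) *: _]scalerDl; ring.
have D1E : (if 0 < D + 1 then llt_ee s (D + 1) (a - 1) b
    else q ^ (1 - (D + 1)) *: llt_ee s 1 (a - 1) b) = q ^ (- D) *: llt_ee s 1 (a - 1) b.
  case: ifP => D1; last by have -> : 1 - (D + 1) = - D by lia.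
  have Dz : D = 0 by lia.
  by rewrite Dz oppr0 expr0z scale1r.
rewrite {}D1E; have -> : (0 < D - 1) = false by lia.
have -> : 1 - (D - 1) = 1 - D + 1 by lia.
rewrite scale1r scalerA qb -(qb (1 - D)) (mulrC q) -!scalerA.
have -> : - D + 1 = 1 - D by lia.
have -> : q ^ b *: (ee s (a - 1) b + ee s a (b - 1))
   + (q - 1) *: (ee_sum s b (a + 1 - 1) (b - 1) + ee_sum s b (a + 1) (b - 1 - 1))
   = llt_ee s 1 (a - 1) b + q *: llt_ee s 1 a (b - 1).
  by rewrite /llt_ee qZ addrACA -!scalerDr addrK subrK.
move: (llt_ee s 1 a b) (llt_ee s 1 (a - 1) b) (llt_ee s 1 a (b - 1)) => A B C.
move: (llt_ee s 1 (a - 1) (b - 1)) (q ^ (1 - D)) => E c.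
by rewrite [q *: (c *: E)]scalerA (mulrC q c) -scalerA !scalerDr !scalerAr; ring.
Qed.

Lemma llt_ee_step xs a b : b <= L%:Z ->
  q ^ (- b) *: llt_ee xs 1 a b = (ee xs a b - ee xs (a + 1) (b - 1))
  + q *: (q ^ (- (b - 1)) *: llt_ee xs 1 (a + 1) (b - 1)).
Proof.
move=> bL; rewrite /llt_ee [ee_sum xs b _ _]ee_sumS; last by lia.
have qV n (Y : V) : q ^ (- n) *: (q ^ n *: Y) = Y.
  by rewrite scalerA -expfzDr // addNr expr0z scale1r.
have sC (c d : F) (Y : V) : c *: (d *: Y) = d *: (c *: Y) by rewrite !scalerA mulrC.
rewrite !(scalerDr (q ^ (- b))) qV (sC (q ^ (- b)) (q - 1)) !(scalerDr (q ^ (- b))) qV.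
rewrite !(scalerDr (q ^ (- (b - 1)))) qV (sC (q ^ (- (b - 1))) (q - 1)) !ee_sumXZ.
rewrite (scalerDr q) (sC q) ee_sumZ.
have -> : - (b - 1) + (b - 1) + 1 = - b + (b + 1) by lia.
have -> : a + 1 + 1 = a + 2 by lia.
by rewrite scalerDr scalerBl scale1r; ring.
Qed.

End ClosedForm.

End Walk.

(** * Walks and pairs of sets *)

Section Words.

Variables (F : fieldType) (V : comAlgType F) (wA wB wAB : int -> F).

Lemma big_ffun_recl (T : finType) n (G : {ffun 'I_n.+1 -> T} -> V) :
  \sum_f G f = \sum_(c : T) \sum_(g : {ffun 'I_n -> T})
    G [ffun i => if unlift ord0 i is Some j then g j else c].
Proof.
rewrite pair_big /=.
pose h (p : T * {ffun 'I_n -> T}) : {ffun 'I_n.+1 -> T} :=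
  [ffun i => if unlift ord0 i is Some j then p.2 j else p.1].
rewrite (reindex h) //; exists (fun f : {ffun 'I_n.+1 -> T} => (f ord0, [ffun j => f (lift ord0 j)])).
- move=> [c g] _; rewrite /h /= ffunE unlift_none; congr (_, _).
  by apply/ffunP => j; rewrite !ffunE liftK.
- by move=> f _; apply/ffunP => i; rewrite ffunE; case: unliftP => [j|] -> //=; rewrite ffunE.
Qed.

Definition walk_weight (c : bool * bool) (D : int) : F :=
  if c.1 then (if c.2 then wAB D else wA D) else (if c.2 then wB D else 1).

Lemma sum_words_walk N (x : 'I_N -> V) (D a b : int) :
  \sum_(f : {ffun 'I_N -> bool * bool} |
         ((\sum_i (f i).1)%N%:Z == a) && ((\sum_i (f i).2)%N%:Z == b))
     \prod_i (walk_weight (f i)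
                (D + (\sum_(u : 'I_N | (u < i)%N) (f u).1)%N%:Z
                   - (\sum_(u : 'I_N | (u < i)%N) (f u).2)%N%:Z)
              *: (x i ^+ (f i).1 * x i ^+ (f i).2))
  = walk wA wB wAB [seq x i | i <- enum 'I_N] D a b.
Proof.
elim: N x D a b => [|N IH] x D a b.
  have -> : enum 'I_0 = [::] by apply: size0nil; rewrite size_enum_ord.
  rewrite big_mkcond (big_pred1 [ffun=> (false, false)]); last first.
    by move=> f; apply/esym/eqP/ffunP => -[].
  by rewrite !big_ord0 ![0 == _]eq_sym /=; case: ifP.
rewrite big_mkcond big_ffun_recl.
pose G (c : bool * bool) := walk_weight c D *: (x ord0 ^+ c.1 * x ord0 ^+ c.2)
  * walk wA wB wAB [seq x (lift ord0 i) | i <- enum 'I_N]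
      (D + (c.1 : nat)%:Z - (c.2 : nat)%:Z) (a - (c.1 : nat)%:Z) (b - (c.2 : nat)%:Z).
transitivity (\sum_c G c).
  apply: eq_bigr => c _; rewrite /G -IH big_mkcond big_distrr [RHS]big_mkcond /=.
  apply: eq_bigr => g _.
  set h := finfun _.
  have h0 : h ord0 = c by rewrite ffunE unlift_none.
  have hS i : h (lift ord0 i) = g i by rewrite ffunE liftK.
  have total (p : bool * bool -> nat) :
      (\sum_i p (h i) = p c + \sum_i p (g i))%N.
    by rewrite big_ord_recl h0; congr addn; apply: eq_bigr => i _; rewrite hS.
  have prefix0 (p : bool * bool -> nat) :
      (\sum_(u : 'I_N.+1 | (u < @ord0 N)%N) p (h u) = 0)%N.
    by rewrite big_pred0.
  have prefixS (p : bool * bool -> nat) (i : 'I_N) :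
      (\sum_(u : 'I_N.+1 | (u < @lift N.+1 ord0 i)%N) p (h u)
       = p c + \sum_(u : 'I_N | (u < i)%N) p (g u))%N.
    rewrite big_mkcond big_ord_recl lift0 /= h0 [in RHS]big_mkcond; congr addn.
    by apply: eq_bigr => u _; rewrite hS /bump add1n ltnS.
  rewrite (total (fun c => nat_of_bool c.1)) (total (fun c => nat_of_bool c.2)) /=.
  rewrite big_ord_recl h0 (prefix0 (fun c : bool * bool => nat_of_bool c.1)).
  rewrite (prefix0 (fun c : bool * bool => nat_of_bool c.2)) addr0 subr0.
  have -> m n (z : int) : ((m + n)%N%:Z == z) = (n%:Z == z - m%:Z) by lia.
  have -> m n (z : int) : ((m + n)%N%:Z == z) = (n%:Z == z - m%:Z) by lia.
  case: ifP => // _; congr (_ * _); apply: eq_bigr => i _.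
  rewrite hS; congr (walk_weight _ _ *: _).
  have := prefixS (fun c : bool * bool => nat_of_bool c.1) i.
  have := prefixS (fun c : bool * bool => nat_of_bool c.2) i.
  by move=> /= -> ->; rewrite !PoszD; lia.
rewrite -(pair_big xpredT xpredT (fun c1 c2 => G (c1, c2))) /= !big_bool /G /=.
rewrite enum_ordSl /= -map_comp /walk_weight /=.
have z1 (z : int) : z + 1%N%:Z - 1%N%:Z = z by lia.
have z0 (z : int) : z + 0%N%:Z = z by lia.
have z0' (z : int) : z - 0%N%:Z = z by lia.
rewrite !(z1, z0, z0') expr0 expr1 !mul1r !mulr1 scale1r mul1r -expr2.
by rewrite -!scalerAl !scalerAr; ring.
Qed.

End Words.

Lemma sum_sets_walk (F : fieldType) (V : comAlgType F) (wA wB wAB : int -> F)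
    N (x : 'I_N -> V) (D : int) (a b : nat) :
  \sum_(AB : {set 'I_N} * {set 'I_N} | (#|AB.1| == a) && (#|AB.2| == b))
     (\prod_i walk_weight wA wB wAB (i \in AB.1, i \in AB.2)
        (D + #|[set u in AB.1 | (u < i)%N]|%:Z - #|[set u in AB.2 | (u < i)%N]|%:Z))
     *: (\prod_(i in AB.1) x i * \prod_(i in AB.2) x i)
  = walk wA wB wAB [seq x i | i <- enum 'I_N] D a b.
Proof.
rewrite -sum_words_walk.
pose h (f : {ffun 'I_N -> bool * bool}) := ([set i | (f i).1], [set i | (f i).2]).
rewrite (reindex h); last first.
  exists (fun AB : {set 'I_N} * {set 'I_N} => [ffun i => (i \in AB.1, i \in AB.2)]).
    move=> f _; apply/ffunP => i; rewrite ffunE !inE.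
    by case: (f i).
  by move=> [A B] _; congr (_, _); apply/setP => i; rewrite !inE ffunE.
have cardE (p : 'I_N -> bool) : #|[set i | p i]| = (\sum_i p i)%N.
  by rewrite -sum1dep_card big_mkcond; apply: eq_bigr => i _; case: (p i).
have prefixE (p : 'I_N -> bool) (v : 'I_N) :
    #|[set u in [set i | p i] | (u < v)%N]| = (\sum_(u : 'I_N | (u < v)%N) p u)%N.
  rewrite -sum1dep_card [LHS]big_mkcond [RHS]big_mkcond.
  by apply: eq_bigr => i _; rewrite inE andbC; case: (i < v)%N => //; case: (p i).
have prodE (p : 'I_N -> bool) : \prod_(i in [set i | p i]) x i = \prod_i x i ^+ p i.
  by rewrite big_mkcond; apply: eq_bigr => i _; rewrite inE; case: (p i).
apply: eq_big => [f|f _]; first by rewrite /h /= !cardE !eqz_nat.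
rewrite /h /= !prodE -big_split /= -scaler_prod; apply: eq_bigr => i _.
by rewrite !prefixE !inE -surjective_pairing.
Qed.

Lemma card_ord_lt a m : (m <= a)%N -> #|[set i : 'I_a | (i < m)%N]| = m.
Proof.
move=> le_ma; rewrite -sum1dep_card -(big_ord_widen _ (fun=> 1%N) le_ma).
by rewrite sum1_card card_ord.
Qed.

Lemma card_ord_between a l r : (r <= a)%N ->
  #|[set y : 'I_a | (l <= y < r)%N]| = (r - l)%N.
Proof.
move=> le_r; case: (leqP l r) => [le_l|lt_r]; last first.
  rewrite (_ : [set y : 'I_a | _] = set0) ?cards0; first by lia.
  by apply/setP => y; rewrite !inE; lia.
have -> : [set y : 'I_a | (l <= y < r)%N] =
    [set y : 'I_a | (y < r)%N] :\: [set y : 'I_a | (y < l)%N].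
  by apply/setP => y; rewrite !inE -leqNgt.
rewrite cardsDS ?card_ord_lt ?(leq_trans le_l) //.
by apply/subsetP => y; rewrite !inE; lia.
Qed.

Lemma mem_initial a (S : {set 'I_a}) (i : 'I_a) :
  (forall j j' : 'I_a, (j <= j')%N -> j' \in S -> j \in S) -> (i \in S) = (i < #|S|)%N.
Proof.
move=> down; apply/idP/idP => [Si|].
  rewrite -[X in (X <= _)%N](card_ord_lt (ltn_ord i)) subset_leq_card //.
  by apply/subsetP => j; rewrite inE ltnS => le_j; apply: down Si.
apply: contraLR; rewrite -leqNgt => nSi.
rewrite -[X in (_ <= X)%N](card_ord_lt (ltnW (ltn_ord i))) subset_leq_card //.
apply/subsetP => j Sj; rewrite inE ltnNge.
by apply: contra nSi => le_ij; apply: down Sj.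
Qed.

Section Strict.

Variable N : nat.

Definition strict a (f : 'I_a -> 'I_N) : bool :=
  [forall i : 'I_a, forall j : 'I_a, (i < j)%N ==> (f i < f j)%N].

Definition values a (f : 'I_a -> 'I_N) : {set 'I_N} := [set f i | i : 'I_a].

Lemma strictP a (f : 'I_a -> 'I_N) :
  reflect {homo f : i j / (i < j)%N} (strict f).
Proof.
apply: (iffP forallP) => [H i j|H i]; first by move/forallP/(_ j)/implyP: (H i); apply.
by apply/forallP => j; apply/implyP; apply: H.
Qed.

Lemma strict_mono a (f : 'I_a -> 'I_N) : strict f -> {mono f : i j / (i < j)%N}.
Proof.
move/strictP => sf i j; apply/idP/idP; last exact: sf.
by apply: contraLR; rewrite -!leqNgt leq_eqVlt => /predU1P[/val_inj ->//|/sf/ltnW].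
Qed.

Lemma strict_inj a (f : 'I_a -> 'I_N) : strict f -> injective f.
Proof.
move/strictP => sf i j E; apply/val_inj.
by case: (ltngtP i j) => // /sf; rewrite E ltnn.
Qed.

Lemma card_values a (f : 'I_a -> 'I_N) : strict f -> #|values f| = a.
Proof. by move=> sf; rewrite card_imset ?card_ord //; exact: strict_inj. Qed.

Lemma lt_card_values a (f : 'I_a -> 'I_N) (i : 'I_a) (w : 'I_N) : strict f ->
  (i < #|[set v in values f | (v < w)%N]|)%N = (f i < w)%N.
Proof.
move=> sf; have -> : [set v in values f | (v < w)%N] = f @: [set j | (f j < w)%N].
  apply/setP => v; rewrite inE; apply/andP/imsetP.
    by move=> [/imsetP[j _ ->] lt_w]; exists j; rewrite ?inE.
  by move=> [j]; rewrite inE => lt_w ->; rewrite imset_f.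
rewrite card_imset; last exact: strict_inj.
rewrite -mem_initial ?inE // => j j' le_j; rewrite !inE => lt_w.
by apply: leq_ltn_trans lt_w; rewrite leqNgt (strict_mono sf) -leqNgt.
Qed.

Lemma card_values_lt a (f : 'I_a -> 'I_N) (i : 'I_a) : strict f ->
  #|[set v in values f | (v < f i)%N]| = i.
Proof.
move=> sf; apply/eqP; rewrite eqn_leq leqNgt.
have := lt_card_values i (f i) sf; rewrite ltnn => ->.
case: i => -[|i] lt_i //=; have lt_i' := ltnW lt_i.
by rewrite (lt_card_values (Ordinal lt_i') _ sf) (strict_mono sf).
Qed.

Lemma strict_eq a (f g : 'I_a -> 'I_N) : strict f -> strict g ->
  values f = values g -> f =1 g.
Proof.
move=> sf sg E i; apply/val_inj; case: (ltngtP (f i) (g i)) => //.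
  by rewrite -(lt_card_values i _ sf) E lt_card_values // ltnn.
by rewrite -(lt_card_values i _ sg) -E lt_card_values // ltnn.
Qed.

Lemma strict_exists (A : {set 'I_N}) a : #|A| = a ->
  exists2 f : {ffun 'I_a -> 'I_N}, strict f & values f = A.
Proof.
move=> <-{a}; exists [ffun i => enum_val i].
  apply/strictP => i j lt_ij; rewrite !ffunE.
  have srt : sorted (relpre val ltn) (enum A).
    rewrite {1}/enum_mem -enumT sorted_filter //; first by move=> x y z; apply: ltn_trans.
    by rewrite -sorted_map val_enum_ord iota_ltn_sorted.
  have x0 : 'I_N by exact: enum_val i.
  rewrite !(enum_val_nth x0).
  have := @sorted_ltn_nth _ (relpre val ltn) _ x0 _ srt.
  by apply; rewrite ?inE -?cardE // => x y z; apply: ltn_trans.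
apply/setP => v; apply/imsetP/idP => [[i _ ->]|Av]; first by rewrite ffunE enum_valP.
by exists (enum_rank_in Av v); rewrite ?ffunE ?enum_rankK_in.
Qed.

End Strict.

(** * Two-column tableaux *)

Section TwoColumns.

Variables (N : nat) (I : finType) (a b : nat) (phi : 'I_a -> I) (psi : 'I_b -> I).

Definition columns (s : 'I_a + 'I_b) : I :=
  match s with inl i => phi i | inr j => psi j end.

Hypothesis columns_bij : bijective columns.

Lemma sum_two_columns (V : nmodType) (H : {set 'I_N} -> {set 'I_N} -> V) :
  \sum_(T : {ffun I -> 'I_N} | strict (T \o phi) && strict (T \o psi))
     H (values (T \o phi)) (values (T \o psi))
  = \sum_(AB : {set 'I_N} * {set 'I_N} | (#|AB.1| == a) && (#|AB.2| == b)) H AB.1 AB.2.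
Proof.
pose h (T : {ffun I -> 'I_N}) := (values (T \o phi), values (T \o psi)).
rewrite (partition_big h (fun AB => (#|AB.1| == a) && (#|AB.2| == b))); last first.
  by move=> T /andP[sA sB]; rewrite /h /= !card_values ?eqxx.
apply: eq_bigr => -[A B] /= /andP[/eqP cA /eqP cB].
have [f sf fA] := strict_exists cA; have [g sg gB] := strict_exists cB.
have [inv invK Kinv] := columns_bij.
pose T0 : {ffun I -> 'I_N} :=
  [ffun c => match inv c with inl i => f i | inr j => g j end].
have T0phi : T0 \o phi =1 f by move=> i; rewrite /= ffunE (invK (inl i)).
have T0psi : T0 \o psi =1 g by move=> i; rewrite /= ffunE (invK (inr i)).
have eq_strict m (u v : 'I_m -> 'I_N) : u =1 v -> strict v -> strict u.
  by move=> E /strictP sv; apply/strictP => i j lt_ij; rewrite !E sv.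
have eq_values m (u v : 'I_m -> 'I_N) : u =1 v -> values u = values v.
  by move=> E; apply: eq_imset.
rewrite (big_pred1 T0) => [|T].
  by rewrite (eq_values _ _ _ T0phi) (eq_values _ _ _ T0psi) fA gB.
apply/andP/eqP => [[/andP[sA sB] /eqP[EA EB]]| ->]; last first.
  split; first by rewrite (eq_strict _ _ _ T0phi sf) (eq_strict _ _ _ T0psi sg).
  by rewrite /h (eq_values _ _ _ T0phi) (eq_values _ _ _ T0psi) fA gB.
apply/ffunP => c; rewrite ffunE -[in LHS](Kinv c); case: (inv c) => i /=.
  by apply: (strict_eq sA sf); rewrite EA fA.
by apply: (strict_eq sB sg); rewrite EB gB.
Qed.

Lemma prod_two_columns (R : comPzRingType) (x : 'I_N -> R) (T : {ffun I -> 'I_N}) :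
  strict (T \o phi) -> strict (T \o psi) ->
  \prod_c x (T c) = \prod_(i in values (T \o phi)) x i * \prod_(i in values (T \o psi)) x i.
Proof.
move=> sA sB; rewrite (reindex columns) /=; last exact: onW_bij.
rewrite big_sumType /= /values.
congr (_ * _); rewrite big_imset //= => i j _ _.
  exact: (strict_inj sA).
exact: (strict_inj sB).
Qed.

End TwoColumns.

Definition vars (N : nat) : seq (mpoly N Qqt) := [seq 'X_i | i <- enum 'I_N].

Lemma two_column_cells (la : seq nat) b : (b <= size la)%N ->
  (forall i, (i < size la)%N -> nth 0%N la i = if (i < b)%N then 2 else 1%N) ->
  exists (phi : 'I_(size la) -> cell la) (psi : 'I_b -> cell la),
    [/\ forall i, val (val (phi i)).1 = i /\ val (val (phi i)).2 = 0%N,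
        forall j, val (val (psi j)).1 = j /\ val (val (psi j)).2 = 1%N &
        bijective (columns phi psi)].
Proof.
move=> le_b la_i.
have hd i : (i < size la)%N -> head 0%N la = if (0 < b)%N then 2 else 1%N.
  by move=> lt_i; rewrite -nth0 la_i //; apply: leq_ltn_trans lt_i.
have phi_ex (i : 'I_(size la)) : exists c : cell la,
    val (val c).1 = i /\ val (val c).2 = 0%N.
  have h0 : (0 < head 0%N la)%N by rewrite (hd i) //; case: ifP.
  have hi : ((Ordinal h0 : nat) < nth 0%N la i)%N by rewrite la_i //; case: ifP.
  by exists (Sub (i, Ordinal h0) hi).
have psi_ex (j : 'I_b) : exists c : cell la, val (val c).1 = j /\ val (val c).2 = 1%N.
  have lt_j : (j < size la)%N by apply: leq_trans le_b.
  have h1 : (1 < head 0%N la)%N by rewrite (hd j) // (leq_ltn_trans _ (ltn_ord j)).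
  have hj : ((Ordinal h1 : nat) < nth 0%N la (Ordinal lt_j))%N by rewrite la_i //= ltn_ord.
  by exists (Sub (Ordinal lt_j, Ordinal h1) hj).
have [phi phiP] := fin_all_exists phi_ex; have [psi psiP] := fin_all_exists psi_ex.
exists phi, psi; split=> //.
have inj : injective (columns phi psi).
  move=> [i|j] [i'|j'] /= E.
  - by congr inl; apply/val_inj; rewrite /= -(phiP i).1 E (phiP i').1.
  - by have := (phiP i).2; rewrite E (psiP j').2.
  - by have := (phiP i').2; rewrite -E (psiP j).2.
  - by congr inr; apply/val_inj; rewrite /= -(psiP j).1 E (psiP j').1.
have surj (c : cell la) : exists s, columns phi psi s = c.
  have := valP c; rewrite la_i //=.
  case: (leqP (val (val c).2) 0) => [|lt0].
    rewrite leqn0 => /eqP c0 _; exists (inl (val c).1).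
    apply/val_inj; rewrite [RHS]surjective_pairing [LHS]surjective_pairing.
    by congr (_, _); apply/val_inj; rewrite /= ((phiP _).1, (phiP _).2) ?c0.
  case: (ltnP (val (val c).1) b) => [lt_b lt2|_]; last by rewrite ltnNge lt0.
  exists (inr (Ordinal lt_b)); apply/val_inj.
  rewrite [RHS]surjective_pairing [LHS]surjective_pairing.
  congr (_, _); apply/val_inj; rewrite /= ((psiP _).1, (psiP _).2) //.
  by apply/eqP; rewrite eqn_leq lt0 -ltnS lt2.
have [g gK] := fin_all_exists surj.
by exists g => // s; apply: inj; rewrite gK.
Qed.

Lemma sum_semistandard (F : fieldType) (V : comAlgType F) N (x : 'I_N -> V)
    (la : seq nat) b : (b <= size la)%N ->
  (forall i, (i < size la)%N -> nth 0%N la i = if (i < b)%N then 2 else 1%N) ->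
  \sum_(T : {ffun cell la -> 'I_N} | semistandard T) \prod_c x (T c)
  = ee [seq x i | i <- enum 'I_N] (size la) b
    - ee [seq x i | i <- enum 'I_N] ((size la)%:Z + 1) (b%:Z - 1).
Proof.
move=> le_b la_i; have [phi [psi [phiP psiP bij]]] := two_column_cells le_b la_i.
have := tableau_walkE [seq x i | i <- enum 'I_N] (lexx 0) (_ : b%:Z <= 0 + (size la)%:Z).
rewrite addr0 subr0 => <-; last by lia.
pose weight (A B : {set 'I_N}) i : F := walk_weight (fun=> 1)
  (fun D => (0 < D)%R%:R) (fun D => (0 <= D)%R%:R) (i \in A, i \in B)
  (0 + #|[set u in A | (u < i)%N]|%:Z - #|[set u in B | (u < i)%N]|%:Z).
rewrite /tableau_walk -sum_sets_walk -(sum_two_columns bij (fun A B =>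
   (\prod_i weight A B i) *: (\prod_(i in A) x i * \prod_(i in B) x i))).
rewrite big_mkcond [RHS]big_mkcond; apply: eq_bigr => T _.
have semiE : semistandard T = [&& strict (T \o phi), strict (T \o psi) &
    [forall j : 'I_b, (T (phi (widen_ord le_b j)) <= T (psi j))%N]].
  apply/idP/and3P.
    move=> /forallP H; have {}H c c' : _ := forallP (H c) c'; split.
    - apply/strictP => i j lt_ij; have /andP[_ /implyP] := H (phi i) (phi j); apply.
      by rewrite -val_eqE /= !(phiP _).2 eqxx !(phiP _).1.
    - apply/strictP => i j lt_ij; have /andP[_ /implyP] := H (psi i) (psi j); apply.
      by rewrite -val_eqE /= !(psiP _).2 eqxx !(psiP _).1.
    - apply/forallP => j.
      have /andP[/implyP H' _] := H (phi (widen_ord le_b j)) (psi j); apply: H'.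
      by rewrite -val_eqE /= (phiP _).1 (psiP _).1 (phiP _).2 (psiP _).2 eqxx.
  move=> [/strictP sA /strictP sB /forallP AB].
  apply/forallP => c; apply/forallP => c'; have [g _ gK] := bij.
  rewrite -(gK c) -(gK c') -!val_eqE /=.
  case: (g c) => [i|j]; case: (g c') => [i'|j'] /=;
    rewrite ?((phiP _).1, (phiP _).2, (psiP _).1, (psiP _).2) ?ltnn ?andbF //=.
  - by apply/implyP; apply: sA.
  - rewrite !andbT; apply/implyP => /eqP E.
    by have -> : i = widen_ord le_b j' by apply/val_inj.
  - by apply/implyP; apply: sB.
rewrite semiE andbA; have [/andP[sA sB] /=|//] :=
  boolP (strict (T \o phi) && strict (T \o psi)).
have weightB j : weight (values (T \o phi)) (values (T \o psi)) (T (psi j))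
    = (T (phi (widen_ord le_b j)) <= T (psi j))%N%:R.
  rewrite /weight /walk_weight /= (imset_f (T \o psi)) //.
  have -> := card_values_lt j sB.
  case: imsetP => [[i _ /= E]|nA].
    rewrite E; have -> := card_values_lt i sA; congr (nat_of_bool _)%:R.
    rewrite leqNgt -[(_ < _)%N]/(((T \o phi) i < (T \o phi) (widen_ord le_b j))%N).
    by rewrite (strict_mono sA) /=; lia.
  congr (nat_of_bool _)%:R.
  rewrite leq_eqVlt -(lt_card_values (widen_ord le_b j) (T (psi j)) sA) /=.
  case: eqP => [/val_inj E|_] /=; last by lia.
  by case: nA; exists (widen_ord le_b j).
rewrite -(prod_two_columns bij x sA sB); case: ifP => [/forallP AB|/forallP AB].
  rewrite [\prod_i weight _ _ i]big1 ?scale1r // => v _.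
  have [/imsetP[j _ ->]|nB] := boolP (v \in values (T \o psi)); first by rewrite weightB AB.
  by rewrite /weight /walk_weight /= (negPf nB); case: ifP.
have [j nj] : exists j, ~~ (T (phi (widen_ord le_b j)) <= T (psi j))%N.
  by apply/existsP; rewrite -negb_forall; apply/forallP.
by rewrite [\prod_i weight _ _ i](bigD1 (T (psi j))) //= weightB (negPf nj) mul0r scale0r.
Qed.

(** * Standardization *)

Lemma sort_perm n (K : 'I_n -> nat) : injective K ->
  exists s : {perm 'I_n},
    (forall y y', (s^-1%g y < s^-1%g y')%N = (K y < K y')%N) /\
    (forall s' : {perm 'I_n}, [forall i : 'I_n, forall j : 'I_n,
         (i.+1 == j :> nat) ==> (K (s' i) < K (s' j))%N] = (s' == s)).
Proof.
move=> K_inj; pose pos y := #|[set y' | (K y' < K y)%N]|.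
have pos_mono y y' : (pos y < pos y')%N = (K y < K y')%N.
  have le_pos z z' : (K z <= K z')%N -> (pos z <= pos z')%N.
    move=> le_K; apply/subset_leq_card/subsetP => w; rewrite !inE => lt_w.
    exact: leq_trans lt_w le_K.
  apply/idP/idP => [|lt_K]; first by apply: contraLR; rewrite -!leqNgt; apply: le_pos.
  apply: proper_card; apply/properP; split.
    by apply/subsetP => w; rewrite !inE => lt_w; apply: ltn_trans lt_w lt_K.
  by exists y; rewrite !inE ?ltnn.
have pos_lt y : (pos y < n)%N.
  rewrite -[X in (_ < X)%N]card_ord -cardsT proper_card //.
  by apply/properP; split; [apply/subsetP | exists y; rewrite !inE ?ltnn].
have pos_inj : injective (fun y => Ordinal (pos_lt y)).
  move=> y y' /(congr1 val) /= E; apply: K_inj.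
  by case: (ltngtP (K y) (K y')) => // lt_K; move: lt_K; rewrite -pos_mono E ltnn.
pose s := ((perm pos_inj)^-1)%g; exists s.
have sK y : val (s^-1%g y) = pos y by rewrite /s invgK permE.
split=> [y y'|s']; first by rewrite !sK pos_mono.
apply/forallP/eqP => [H|->]; last first.
  move=> i; apply/forallP => j; apply/implyP => /eqP E.
  by rewrite -pos_mono -!sK !permK E.
have {}H : {homo (K \o s') : i j / (i < j)%N}.
  move=> i [j lt_j]; elim: j lt_j => // j IH lt_j; rewrite ltnS leq_eqVlt.
  have step : (K (s' (Ordinal (ltnW lt_j))) < K (s' (Ordinal lt_j)))%N.
    by have /forallP/(_ (Ordinal lt_j))/implyP := H (Ordinal (ltnW lt_j)); apply.
  case/predU1P=> [E|lt_i]; last exact: ltn_trans (IH _ lt_i) step.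
  by rewrite /= (_ : i = Ordinal (ltnW lt_j)) //; apply/val_inj.
have {}H i j : (K (s' i) < K (s' j))%N = (i < j)%N.
  apply/idP/idP; last exact: H.
  by apply: contraLR; rewrite -!leqNgt leq_eqVlt => /predU1P[/val_inj->//|/H/ltnW].
apply/permP => i; apply: (can_inj (permKV s)); rewrite permK; apply/val_inj.
rewrite sK /pos -[RHS](card_ord_lt (ltnW (ltn_ord i))).
rewrite -[RHS](card_imset _ (@perm_inj _ s')); congr #|pred_of_set _|.
apply/setP => y; rewrite inE; apply/idP/imsetP.
  by move=> lt_y; exists (s'^-1 y)%g; rewrite ?permKV // inE -H permKV.
by move=> [j]; rewrite inE => lt_j ->; rewrite H.
Qed.

Lemma scanl_pairmap_subn x (s : seq nat) : path leq x s ->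
  scanl addn x (pairmap (fun a b => (b - a)%N) x s) = s.
Proof. by elim: s x => //= y s IH x /andP[le_xy /IH E]; rewrite subnKC // E. Qed.

Lemma sumn_pairmap_subn x (s : seq nat) : path leq x s ->
  (x + sumn (pairmap (fun a b => (b - a)%N) x s))%N = last x s.
Proof.
by elim: s x => [|y s IH] x /=; rewrite ?addn0 // => /andP[le_xy /IH <-]; rewrite addnA subnKC.
Qed.

Lemma fundamental_cast N n alpha : sumn alpha = n -> fundamental N alpha =
  \sum_(w : {ffun 'I_n -> 'I_N} |
         [forall i : 'I_n, forall j : 'I_n, (i.+1 == j :> nat) ==>
            (if i.+1 \in scanl addn 0%N alpha then (w i < w j)%N else (w i <= w j)%N)])
     \prod_i 'X_(w i).
Proof. by move=> <-. Qed.

Lemma fundamental_pides N m n (pi : PFtype m n) : fundamental N (pides pi) =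
  \sum_(w : {ffun 'I_n -> 'I_N} |
         [forall i : 'I_n, forall j : 'I_n, (i.+1 == j :> nat) ==>
            (if (rank pi i < rank pi j)%N then (w i < w j)%N else (w i <= w j)%N)])
     \prod_i 'X_(w i).
Proof.
have ides_lt : all (fun i => i <= n)%N (ides pi).
  by apply/allP => i /mapP[b _ ->]; exact: ltnW (ltn_ord b).
have srt : path leq 0 (rcons (ides pi) n).
  rewrite rcons_path; apply/andP; split; last first.
    by have := mem_last 0%N (ides pi); rewrite inE => /predU1P[->|/(allP ides_lt)].
  rewrite (path_sortedE leq_trans) all_predT /= /ides sorted_map.
  apply: sorted_filter; first by move=> x y z; exact: leq_trans.
  by rewrite -sorted_map val_enum_ord; exact: iota_sorted.
rewrite (@fundamental_cast N n); last first.
  by rewrite -[LHS]add0n sumn_pairmap_subn // last_rcons.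
rewrite scanl_pairmap_subn //; apply: eq_bigl => w.
apply: eq_forallb => i; apply: eq_forallb => j.
case: eqP => //= E; have -> // : (i.+1 \in rcons (ides pi) n) = (rank pi i < rank pi j)%N.
rewrite mem_rcons inE E (ltn_eqF (ltn_ord j)) /= mem_map; last exact: val_inj.
rewrite mem_filter mem_enum andbT; apply/existsP/idP => [[a /andP[/eqP Ea]]|lt_rk].
  by have -> : a = i by apply/val_inj/eq_add_S; rewrite Ea E.
by exists i; rewrite E eqxx.
Qed.

Section Standardization.

Variables (N m n : nat) (u : {ffun 'I_n -> 'I_m}).

Definition height_rank (y : 'I_n) : nat :=
  (m * y - n * u y + u y * gcdn m n %/ m)%N.

Lemma rankE (s : {perm 'I_n}) i : rank (u, s) i = height_rank (s i).
Proof. by []. Qed.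

Definition column_strict (T : {ffun 'I_n -> 'I_N}) : bool :=
  [forall y : 'I_n, forall y' : 'I_n, (u y == u y') && (y < y')%N ==> (T y < T y')%N].

(* Cars are read in increasing order of [T], and by decreasing rank where [T]
   is constant. *)
Definition read_before (T : {ffun 'I_n -> 'I_N}) (y y' : 'I_n) : bool :=
  (T y < T y')%N || (T y == T y') && (height_rank y' < height_rank y)%N.

Hypothesis u_dyck : dyck u.
Hypothesis rank_inj : injective height_rank.
Hypothesis rank_col : forall y y', u y = u y' -> (y < y')%N ->
  (height_rank y < height_rank y')%N.

Lemma reading_perm (T : {ffun 'I_n -> 'I_N}) : exists s : {perm 'I_n},
  (forall y y', (s^-1%g y < s^-1%g y')%N = read_before T y y') /\
  (forall s' : {perm 'I_n}, [forall i : 'I_n, forall j : 'I_n, (i.+1 == j :> nat) ==>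
     (if (rank (u, s') i < rank (u, s') j)%N then (T (s' i) < T (s' j))%N
      else (T (s' i) <= T (s' j))%N)] = (s' == s)).
Proof.
pose R := (\max_y height_rank y).+1%N.
have rkR y : (height_rank y < R)%N by rewrite ltnS; exact: leq_bigmax.
pose K (y : 'I_n) := (T y * R + (R - (height_rank y).+1))%N.
have KE y y' : (K y < K y')%N = read_before T y y'.
  rewrite /K /read_before -val_eqE /=; move: (rkR y) (rkR y') => lt_y lt_y'.
  case: (ltngtP (T y) (T y')) => [lt_T|lt_T|->] /=.
  - have : ((T y).+1 * R <= T y' * R)%N by rewrite leq_mul2r lt_T orbT.
    by rewrite mulSn; clearbody R; lia.
  - have : ((T y').+1 * R <= T y * R)%N by rewrite leq_mul2r lt_T orbT.
    by rewrite mulSn; clearbody R; lia.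
  - by rewrite ltn_add2l; lia.
have K_inj : injective K.
  move=> y y' E; have := KE y y'; have := KE y' y; rewrite E ltnn /read_before.
  rewrite (eq_sym (T y')) -val_eqE /=.
  case: (ltngtP (T y) (T y')) => //= _ /esym nlt /esym nlt'.
  by apply: rank_inj; case: (ltngtP (height_rank y) (height_rank y')) nlt nlt'.
have [s [sK s_uniq]] := sort_perm K_inj; exists s; split=> [y y'|s'].
  by rewrite sK KE.
rewrite -s_uniq; apply: eq_forallb => i; apply: eq_forallb => j.
case: eqP => //= ij; rewrite KE /read_before !rankE -val_eqE /=.
have ne : height_rank (s' i) <> height_rank (s' j).
  by move/rank_inj/perm_inj => E; move: ij; rewrite E => /eqP; rewrite (gtn_eqF (ltnSn j)).
by case: (ltngtP (height_rank (s' i)) (height_rank (s' j))) ne => // _ _; lia.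
Qed.

Lemma parking_reading (T : {ffun 'I_n -> 'I_N}) (s : {perm 'I_n}) :
  (forall y y', (s^-1%g y < s^-1%g y')%N = read_before T y y') ->
  parking (u, s) = column_strict T.
Proof.
move=> sT; rewrite /parking u_dyck /=; apply/forallP/forallP => H.
  move=> y; apply/forallP => y'; apply/implyP => /andP[/eqP ueq lt_y].
  have /forallP/(_ (s^-1%g y'))/implyP := H (s^-1%g y).
  rewrite !permKV ueq eqxx lt_y sT => /(_ isT); rewrite /read_before.
  by case/orP=> // /andP[_]; rewrite ltnNge ltnW // rank_col.
move=> i; apply/forallP => j; apply/implyP => /andP[/eqP ueq lt_s].
rewrite -[i](permK s) -[j](permK s) sT /read_before.
by have /forallP/(_ (s j))/implyP -> := H (s i); rewrite ?ueq ?eqxx.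
Qed.

Lemma sum_fundamental (c : {perm 'I_n} -> Qqt) (d : {ffun 'I_n -> 'I_N} -> Qqt) :
  (forall (s : {perm 'I_n}) T, column_strict T ->
     (forall y y', (s^-1%g y < s^-1%g y')%N = read_before T y y') -> c s = d T) ->
  \sum_(s : {perm 'I_n} | parking (u, s)) c s *: fundamental N (pides (u, s))
  = \sum_(T | column_strict T) d T *: \prod_y 'X_(T y).
Proof.
move=> cd.
transitivity (\sum_(s : {perm 'I_n} | parking (u, s)) \sum_(T : {ffun 'I_n -> 'I_N})
  if [forall i : 'I_n, forall j : 'I_n, (i.+1 == j :> nat) ==>
     (if (rank (u, s) i < rank (u, s) j)%N then (T (s i) < T (s j))%N
      else (T (s i) <= T (s j))%N)]
  then c s *: \prod_y ('X_(T y) : mpoly N Qqt) else 0).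
  apply: eq_bigr => s _; rewrite fundamental_pides scaler_sumr -big_mkcond.
  pose h (T : {ffun 'I_n -> 'I_N}) := [ffun i => T (s i)].
  pose s' : {perm 'I_n} := (s^-1)%g.
  rewrite (reindex h); last first.
    exists (fun w : {ffun 'I_n -> 'I_N} => [ffun y => w (s' y)]).
      by move=> T _; apply/ffunP => y; rewrite !ffunE permKV.
    by move=> w _; apply/ffunP => i; rewrite !ffunE permK.
  apply: eq_big => [T|T _].
    by apply: eq_forallb => i; apply: eq_forallb => j; rewrite !ffunE.
  rewrite [in RHS](reindex_inj (@perm_inj _ s)); apply: congr1; apply: eq_bigr => i _.
  by rewrite ffunE.
rewrite exchange_big [RHS]big_mkcond; apply: eq_bigr => T _.
have [s [sT s_uniq]] := reading_perm T.
rewrite big_mkcond (bigD1 s) // [\big[_/_]_(i | i != s) _]big1 => [|s' ne]; last first.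
  by rewrite s_uniq (negPf ne); case: ifP.
rewrite s_uniq eqxx (parking_reading sT); case: ifP => colT; last exact: addr0.
by rewrite (cd s T colT sT); exact: addr0.
Qed.

End Standardization.

(** * Paths in the 2 x 2k rectangle *)

Section Rectangle2.

Variable k : nat.
Hypothesis k_gt0 : (0 < k)%N.

Definition two_column_path (j : nat) : {ffun 'I_(2 * k) -> 'I_2} :=
  [ffun y : 'I_(2 * k) => if (k + j <= y)%N then ord_max else ord0].

Lemma two_column_pathE j y : two_column_path j y = (k + j <= y)%N :> nat.
Proof. by rewrite ffunE; case: ifP. Qed.

Lemma two_column_path_dyck j : dyck (two_column_path j).
Proof.
apply/andP; split; apply/forallP => y; rewrite ?two_column_pathE.
  by case: (leqP (k + j) y) => ?; lia.
by apply/forallP => y'; apply/implyP; rewrite !two_column_pathE; lia.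
Qed.

Lemma dyck_two_column (u : {ffun 'I_(2 * k) -> 'I_2}) : dyck u ->
  exists j : 'I_k.+1, u = two_column_path j.
Proof.
move=> /andP[/forallP u_le /forallP u_mono].
pose S := [set y | u y == ord0].
have S_initial (y : 'I_(2 * k)) : (u y == ord0) = (y < #|S|)%N.
  have -> : (u y == ord0) = (y \in S) by rewrite inE.
  apply: mem_initial => y1 y2 le_y; rewrite !inE => /eqP u2.
  have /forallP/(_ y2)/implyP/(_ le_y) := u_mono y1.
  by rewrite u2 leqn0 -val_eqE.
have S_le : (#|S| <= 2 * k)%N by rewrite -[X in (_ <= X)%N]card_ord max_card.
have S_ge : (k <= #|S|)%N.
  rewrite leqNgt; apply/negP => lt_k; have lt_2k : (#|S| < 2 * k)%N by lia.
  have := S_initial (Ordinal lt_2k); rewrite /= ltnn -val_eqE /= => u1.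
  have u_gt0 : (0 < u (Ordinal lt_2k))%N by rewrite lt0n u1.
  have := leq_trans (leq_pmulr (2 * k) u_gt0) (u_le (Ordinal lt_2k)).
  by rewrite leq_pmul2l // leqNgt lt_k.
have lt_j : (#|S| - k < k.+1)%N by lia.
exists (Ordinal lt_j); apply/ffunP => y; apply/val_inj.
rewrite /= two_column_pathE /= subnKC // leqNgt -S_initial -val_eqE /=.
by case: (u y) => -[|[|]].
Qed.

Lemma sum_dyck_two_column (V : nmodType) (G : {ffun 'I_(2 * k) -> 'I_2} -> V) :
  \sum_(u | dyck u) G u = \sum_(j < k.+1) G (two_column_path j).
Proof.
have inj : injective (fun j : 'I_k.+1 => two_column_path j).
  have lt_absurd (j j' : 'I_k.+1) : (j < j')%N -> two_column_path j = two_column_path j' -> False.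
    move=> lt_j E; have lt_2k : (k + j < 2 * k)%N by have := ltn_ord j'; lia.
    have := congr1 (fun u : {ffun 'I_(2 * k) -> 'I_2} => u (Ordinal lt_2k) : nat) E.
    by rewrite !two_column_pathE /=; lia.
  move=> j j' E; apply/val_inj; case: (ltngtP j j') => // lt_j.
    by case: (lt_absurd _ _ lt_j E).
  by case: (lt_absurd _ _ lt_j (esym E)).
rewrite -(big_imset _ (in2W inj)) /=; apply: eq_bigl => u.
apply/idP/imsetP => [/dyck_two_column[j ->]|[j _ ->]]; first by exists j.
exact: two_column_path_dyck.
Qed.

Variable j : nat.
Hypothesis le_jk : (j <= k)%N.

Let u := two_column_path j.

Lemma height_rank2E (y : 'I_(2 * k)) :
  height_rank u y = if (k + j <= y)%N then (2 * (y - k)).+1 else (2 * y)%N.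
Proof.
rewrite /height_rank two_column_pathE gcdnMr; case: (leqP (k + j) y) => le_y.
  by rewrite mul1n divnn /=; lia.
by rewrite muln0 subn0 mul0n div0n addn0.
Qed.

Lemma height_rank2_inj : injective (height_rank u).
Proof.
move=> y y'; rewrite !height_rank2E => E; apply/val_inj => /=.
by move: E; do 2 case: leqP => ?; lia.
Qed.

Lemma height_rank2_col y y' : u y = u y' -> (y < y')%N ->
  (height_rank u y < height_rank u y')%N.
Proof.
move/(congr1 val); rewrite /= !two_column_pathE !height_rank2E.
by case: (leqP (k + j) y) => ?; case: (leqP (k + j) y') => ? //=; lia.
Qed.

Lemma card_pair_ord0 (P : pred ('I_2 * 'I_(2 * k))) :
  (forall y, ~~ P (ord_max, y)) -> #|[set c | P c]| = #|[set y | P (ord0, y)]|.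
Proof.
move=> P1; have inj0 : injective (fun y : 'I_(2 * k) => (ord0 : 'I_2, y)) by move=> y y' [].
rewrite -[RHS](card_imset _ inj0); apply: eq_card => -[x y].
rewrite inE; apply/idP/imsetP => [Pxy|[y']]; last by rewrite inE => Py' [-> ->].
have [x0|x1] : x = ord0 \/ x = ord_max.
  by case: x {Pxy} => -[|[|//]] h; [left | right]; apply/val_inj.
  by exists y; rewrite ?inE -?x0.
by case/negP: (P1 y); rewrite -x1.
Qed.

Lemma area2 : area u = j.
Proof.
rewrite /area card_pair_ord0 => [|y]; last first.
  by rewrite /= ; have := ltn_ord y; lia.
rewrite -[RHS](addKn k) -[RHS](@card_ord_between (2 * k) k); last by lia.
by apply: eq_card => y; rewrite !inE /= two_column_pathE muln1; lia.
Qed.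

Lemma pdinv2 : pdinv u = (k - j)%N.
Proof.
have aboveE x y : ((x, y) \in above u) = (x == ord0) && (k + j <= y)%N.
  rewrite inE /= two_column_pathE -val_eqE /=.
  by case: (leqP (k + j) y); case: x => -[|[|]].
have armE y : arm u (ord0, y) = 0%N.
  apply/eqP; rewrite cards_eq0; apply/eqP/setP => -[x y'].
  rewrite inE aboveE in_set0 /= -val_eqE /=.
  by case: x => -[|[|//]] h /=; rewrite ?ltnn ?andbF.
have legE y : leg u (ord0, y) = (y - (k + j))%N.
  rewrite /leg -[RHS](@card_ord_between (2 * k) (k + j) y); last exact: ltnW.
  rewrite card_pair_ord0 => [|y']; last by rewrite aboveE.
  apply: eq_card => y'; rewrite [LHS]in_set [RHS]in_set /= aboveE.
  by [].
rewrite /pdinv card_pair_ord0 => [|y]; last by rewrite aboveE.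
have -> : (k - j)%N = (2 * k - (k + j))%N by lia.
rewrite -(@card_ord_between (2 * k)) //; apply: eq_card => y.
rewrite [LHS]in_set [RHS]in_set aboveE armE legE /= muln0 muln1 leq0n ltn_ord andbT /=.
by case: (leqP (k + j) y) => //= _; have := ltn_ord y; lia.
Qed.

Lemma ret2 : ret u = (if j == 0 then 1 else 2)%N.
Proof.
have pass1 : passes u 1 k = (j == 0)%N.
  apply/forallP/eqP => [H|j0 z]; last first.
    by rewrite two_column_pathE j0 addn0; case: ltnP.
  case: (posnP j) => // j_gt0; have lt_2k : (k < 2 * k)%N by lia.
  by have := H (Ordinal lt_2k); rewrite two_column_pathE /= ltnn; lia.
have pass2 : passes u 2 (2 * k).
  by apply/forallP => z; rewrite ltn_ord; exact: ltnW.
rewrite /ret gcdnMr divnn mulKn //= !mul1n pass1 pass2.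
by case: (j == 0%N).
Qed.

Lemma tdinv2 (s : {perm 'I_(2 * k)}) :
  tdinv (u, s) = #|[set yy : 'I_(2 * k) * 'I_(2 * k) |
    (s^-1%g yy.1 < s^-1%g yy.2)%N && (height_rank u yy.2 == (height_rank u yy.1).+1)]|.
Proof.
have inj : injective (fun ij : 'I_(2 * k) * 'I_(2 * k) => (s ij.1, s ij.2)).
  by move=> [i i'] [l l'] [/perm_inj -> /perm_inj ->].
rewrite /tdinv -(card_imset _ inj); apply: eq_card => -[y y'].
rewrite inE /=; apply/imsetP/idP => [[[i i']]|/andP[lt_s /eqP E]].
  rewrite inE /= !rankE => /and3P[lt_i lt_r le_r] [-> ->].
  by rewrite !permK lt_i; lia.
exists (s^-1%g y, s^-1%g y'); rewrite ?inE /= ?rankE ?permKV //.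
by rewrite lt_s E; lia.
Qed.

End Rectangle2.

Section Inversions.

Variables k j : nat.
Hypotheses (k_gt0 : (0 < k)%N) (le_jk : (j <= k)%N).

Let u := two_column_path k j.

Fact left_height_subproof : (k + j <= 2 * k)%N. Proof. by lia. Qed.

Definition left_height (l : 'I_(k + j)) : 'I_(2 * k) := widen_ord left_height_subproof l.

Fact right_height_subproof (i : 'I_(k - j)) : (k + j + i < 2 * k)%N.
Proof. by have := ltn_ord i; lia. Qed.

Definition right_height (i : 'I_(k - j)) : 'I_(2 * k) := Ordinal (right_height_subproof i).

Lemma heights_bij : bijective (columns left_height right_height).
Proof.
apply: inj_card_bij; last by rewrite card_sum !card_ord; lia.
move=> [l|i] [l'|i'] /(congr1 val) /= E; first by congr inl; apply/val_inj.
- by have := ltn_ord l; lia.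
- by have := ltn_ord l'; lia.
- by congr inr; apply/val_inj; move: E => /= /eqP; rewrite eqn_add2l => /eqP.
Qed.

Lemma left_rank l : height_rank u (left_height l) = (2 * l)%N.
Proof. by rewrite height_rank2E //= leqNgt ltn_ord. Qed.

Lemma right_rank i : height_rank u (right_height i) = (2 * (j + i)).+1%N.
Proof. by rewrite height_rank2E //= leq_addr; lia. Qed.

Lemma path_left l : u (left_height l) = ord0.
Proof. by apply/val_inj; rewrite /= two_column_pathE /= leqNgt ltn_ord. Qed.

Lemma path_right i : u (right_height i) = ord_max.
Proof. by apply/val_inj; rewrite /= two_column_pathE /= leq_addr. Qed.

Lemma column_strict2 N (T : {ffun 'I_(2 * k) -> 'I_N}) :
  column_strict u T = strict (T \o left_height) && strict (T \o right_height).
Proof.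
apply/idP/andP => [/forallP H|[/strictP sl /strictP sr]].
  split; apply/strictP => i i' lt_i /=.
    have /forallP/(_ (left_height i'))/implyP := H (left_height i); apply.
    by rewrite !path_left eqxx.
  have /forallP/(_ (right_height i'))/implyP := H (right_height i); apply.
  by rewrite !path_right eqxx /= ltn_add2l.
apply/forallP => y; apply/forallP => y'; have [g _ gK] := heights_bij.
rewrite -(gK y) -(gK y'); case: (g y) => z; case: (g y') => z' /=; apply/implyP.
- by case/andP=> _; apply: sl.
- by rewrite path_left path_right.
- by rewrite path_left path_right.
- by case/andP=> _; rewrite ltn_add2l; apply: sr.
Qed.

Lemma card_adjacent (P : rel 'I_(2 * k)) :
  #|[set yy : 'I_(2 * k) * 'I_(2 * k) |
      P yy.1 yy.2 && (height_rank u yy.2 == (height_rank u yy.1).+1)]|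
  = (\sum_(i < k - j) \sum_(l < k + j) (l == j + i :> nat) * P (left_height l) (right_height i)
   + \sum_(l < k + j) \sum_(i < k - j) (l == (j + i).+1 :> nat) * P (right_height i) (left_height l))%N.
Proof.
pose G y y' : nat := P y y' && (height_rank u y' == (height_rank u y).+1).
transitivity (\sum_y \sum_y' G y y')%N.
  rewrite -sum1dep_card big_mkcond pair_big /=; apply: eq_bigr => -[y y'] _ /=.
  by rewrite /G; case: ifP.
have split_sum (f : 'I_(2 * k) -> nat) : (\sum_y f y =
    \sum_(l < k + j) f (left_height l) + \sum_(i < k - j) f (right_height i))%N.
  by rewrite (reindex _ (onW_bij _ heights_bij)) big_sumType.
rewrite split_sum.
under eq_bigr => l _ do rewrite split_sum.
under [X in (_ + X)%N]eq_bigr => i _ do rewrite split_sum.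
rewrite !big_split /= big1 => [|l _]; last first.
  by rewrite big1 // => l' _; rewrite /G !left_rank; case: eqP => [|_]; [lia | rewrite andbF].
rewrite [X in (_ + (_ + X))%N]big1 => [|i _]; last first.
  by rewrite big1 // => i' _; rewrite /G !right_rank; case: eqP => [|_]; [lia | rewrite andbF].
rewrite add0n addn0 exchange_big [X in (_ + X)%N]exchange_big /=; congr addn.
  apply: eq_bigr => i _; apply: eq_bigr => l _; rewrite /G left_rank right_rank.
  by rewrite mulnb andbC; congr (nat_of_bool (_ && _)); apply/eqP/eqP; lia.
apply: eq_bigr => l _; apply: eq_bigr => i _; rewrite /G left_rank right_rank.
by rewrite mulnb andbC; congr (nat_of_bool (_ && _)); apply/eqP/eqP; lia.
Qed.

Lemma sum_ord_pick a p (Q : nat -> bool) :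
  (\sum_(l < a) (l == p :> nat) * Q l)%N = ((p < a)%N && Q p).
Proof.
case: (ltnP p a) => [lt_p|le_a] /=.
  rewrite (bigD1 (Ordinal lt_p)) //= eqxx mul1n big1 ?addn0 // => l.
  by rewrite -val_eqE /= => /negPf ->.
by rewrite big1 // => l _; rewrite (ltn_eqF (leq_trans (ltn_ord l) le_a)).
Qed.

Lemma maxdinv2 : maxdinv u = ((k - j) + (k - j) - (j == 0))%N.
Proof.
have -> : ((k - j) + (k - j) - (j == 0))%N = #|[set yy : 'I_(2 * k) * 'I_(2 * k) |
    xpredT yy.1 && (height_rank u yy.2 == (height_rank u yy.1).+1)]|.
  rewrite (card_adjacent (fun _ _ => true)).
  under eq_bigr => i _ do rewrite (sum_ord_pick _ _ xpredT).
  rewrite [X in (_ = _ + X)%N]exchange_big /=.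
  under [X in (_ = _ + X)%N]eq_bigr => i _ do rewrite (sum_ord_pick _ _ xpredT).
  rewrite (eq_bigr (fun=> 1%N)) => [|i _]; last first.
    by rewrite andbT; case: ltnP => //; have := ltn_ord i; lia.
  rewrite sum1_card card_ord -addnBA; last by lia.
  congr addn; case: (posnP j) => [j0|j_gt0]; last first.
    rewrite subn0 (eq_bigr (fun=> 1%N)) ?sum1_card ?card_ord // => i _.
    by rewrite andbT; case: ltnP => //; have := ltn_ord i; lia.
  rewrite -[LHS](@card_ord_lt (k - j)) ?leq_subr // -sum1dep_card big_mkcond.
  apply: eq_bigr => i _; rewrite andbT.
  have -> : ((j + i).+1 < k + j)%N = (i < k - j - true)%N by have := ltn_ord i; lia.
  by case: ifP.
apply/eqP; rewrite eqn_leq; apply/andP; split.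
  apply/bigmax_leqP => -[v s] /= /andP[_ /eqP ->]; rewrite tdinv2 //.
  by apply/subset_leq_card/subsetP => -[y y']; rewrite !inE /= => /andP[_ ->].
have [s [sK _]] := sort_perm (@height_rank2_inj k k_gt0 j le_jk).
have ps : parking (u, s).
  rewrite /parking two_column_path_dyck //=; apply/forallP => i; apply/forallP => i'.
  apply/implyP => /andP[/eqP ueq lt_s]; rewrite -(permK s i) -(permK s i') sK.
  exact: height_rank2_col.
apply: leq_trans (leq_bigmax_cond (P := fun pi => parking pi && (pi.1 == u)) (u, s) _).
  rewrite tdinv2 //; apply/subset_leq_card/subsetP => -[y y']; rewrite !inE /=.
  by move=> /eqP E; rewrite sK E ltnSn eqxx.
by rewrite ps eqxx.
Qed.

Section Reading.

Variables (N : nat) (T : {ffun 'I_(2 * k) -> 'I_N}).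

Definition inversions : nat := #|[set yy : 'I_(2 * k) * 'I_(2 * k) |
  (T yy.1 < T yy.2)%N && (height_rank u yy.2 == (height_rank u yy.1).+1)]|.

Lemma tdinv_inversions (s : {perm 'I_(2 * k)}) :
  (forall y y', (s^-1%g y < s^-1%g y')%N = read_before u T y y') ->
  tdinv (u, s) = inversions.
Proof.
move=> sT; rewrite tdinv2 //; apply: eq_card => -[y y']; rewrite !inE /= sT /read_before.
have [E|_] := (height_rank u y' =P (height_rank u y).+1); last by rewrite !andbF.
have -> : (height_rank u y' < height_rank u y)%N = false by rewrite E; lia.
by rewrite andbF orbF.
Qed.

Hypothesis colT : column_strict u T.

Let L := T \o left_height.
Let R := T \o right_height.

Lemma inversions_values : (inversions + j.+1 =
  \sum_(i < k - j) (j + i < #|[set v in values L | (v < R i)%N]|)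
  + \sum_(l < k + j) (l <= j + #|[set v in values R | (v < L l)%N]|))%N.
Proof.
have /andP[sL sR] : strict L && strict R by rewrite -column_strict2.
rewrite /inversions (card_adjacent (fun y y' => (T y < T y')%N)) -addnA.
have card_le a (f : 'I_a -> 'I_N) w : strict f -> (#|[set v in values f | (v < w)%N]| <= a)%N.
  move=> sf; rewrite -[X in (_ <= X)%N](card_values sf).
  by apply/subset_leq_card/subsetP => v; rewrite inE => /andP[].
congr addn.
  apply: eq_bigr => i _.
  under eq_bigr => l _ do rewrite -(lt_card_values l (T (right_height i)) sL).
  rewrite (sum_ord_pick _ _ (fun l => l < #|[set v in values L | (v < R i)%N]|)%N).
  by have := card_le _ _ (R i) sL; case: ltnP => //=; lia.
have -> : j.+1 = (\sum_(l < k + j) (l <= j))%N.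
  rewrite -[LHS](@card_ord_lt (k + j) j.+1); last by lia.
  by rewrite -sum1dep_card big_mkcond; apply: eq_bigr => l _; rewrite ltnS; case: ifP.
rewrite -big_split /=; apply: eq_bigr => l _.
under eq_bigr => i _ do rewrite -(lt_card_values i (T (left_height l)) sR).
have := card_le _ _ (L l) sR; rewrite /=.
set b := #|_| => le_b; case: (leqP l j) => [le_l|lt_l].
  by rewrite big1 => [|i _]; [lia | rewrite (_ : (_ == _) = false) //; lia].
rewrite (eq_bigr (fun i : 'I_(k - j) => (i == l - j.+1 :> nat) * (i < b)))%N => [|i _].
  rewrite (sum_ord_pick _ _ (fun i => i < b)%N) addn0.
  by congr nat_of_bool; apply/andP/idP; [case | split]; lia.
by congr ((_ : bool) * _)%N; apply/eqP/eqP; lia.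
Qed.

(* The exponent of [q] in the product of the weights of [llt_walk], started at
   height [-j], is the number of inversions plus [j + 1]: the first [j + 1] cars
   of the left column also contribute, although no car of the right column has
   a rank just below theirs. *)
Lemma prod_llt_weights (F : fieldType) (q : F) :
  \prod_v walk_weight (fun D : int => if D <= 0 then q else 1)
      (fun D : int => if 0 < D then q else 1) (fun=> q)
      (v \in values L, v \in values R)
      (- j%:Z + #|[set w in values L | (w < v)%N]|%:Z - #|[set w in values R | (w < v)%N]|%:Z)
  = q ^+ (inversions + j.+1).
Proof.
have /andP[sL sR] : strict L && strict R by rewrite -column_strict2.
pose al v := #|[set w in values L | (w < v)%N]|.
pose be v := #|[set w in values R | (w < v)%N]|.
transitivity (\prod_v q ^+ ((v \in values L) * (al v <= j + be v)
                            + (v \in values R) * (j + be v < al v))%N).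
  apply: eq_bigr => v _; rewrite /walk_weight /= -/(al v) -/(be v).
  have -> : (- j%:Z + (al v)%:Z - (be v)%:Z <= 0) = (al v <= j + be v)%N by lia.
  have -> : (0 < - j%:Z + (al v)%:Z - (be v)%:Z) = (j + be v < al v)%N by lia.
  by case: (v \in values L); case: (v \in values R); case: leqP;
    rewrite ?mul1n ?mul0n ?addn0 ?add0n ?expr0 ?expr1.
rewrite prodrXr inversions_values big_split /= addnC.
have sum_values a (f : 'I_a -> 'I_N) (P : 'I_N -> bool) : strict f ->
    (\sum_v (v \in values f) * P v = \sum_i P (f i))%N.
  move=> sf; rewrite /values -(big_imset (fun v => nat_of_bool (P v))) /=; last first.
    by move=> x y _ _; exact: (strict_inj sf).
  rewrite [RHS]big_mkcond; apply: eq_bigr => v _.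
  by case: (v \in _); rewrite ?mul1n ?mul0n.
rewrite (sum_values _ R (fun v => j + be v < al v)%N sR).
rewrite (sum_values _ L (fun v => al v <= j + be v)%N sL).
congr (q ^+ (_ + _)); apply: eq_bigr => i _.
  by rewrite /be (card_values_lt i sR).
by rewrite /al (card_values_lt i sL).
Qed.

End Reading.

End Inversions.

Section SumInversions.

Variables (F : fieldType) (V : comAlgType F) (q : F) (N : nat) (x : 'I_N -> V).
Hypothesis q_neq0 : q != 0.

Let xs := [seq x i | i <- enum 'I_N].

Definition llt_term (k : nat) (j : int) : V :=
  q ^ (- (k%:Z - j)) *: llt_ee q k xs 1 (k%:Z + j) (k%:Z - j).

Lemma sum_inversions k j : (0 < k)%N -> (j <= k)%N ->
  \sum_(T : {ffun 'I_(2 * k) -> 'I_N} | column_strict (two_column_path k j) T)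
     q ^ ((inversions j T)%:Z + (j == 0%N)%:Z - (k%:Z - j%:Z)) *: \prod_y x (T y)
  = llt_term k j.
Proof.
move=> k_gt0 le_jk.
have -> : llt_term k j =
    q ^ ((j == 0%N)%:Z - (k%:Z - j%:Z) - j.+1%:Z) *: llt_walk q xs (- j%:Z) (k + j)%N (k - j)%N.
  have -> : (k - j)%N%:Z = k%:Z - j%:Z by lia.
  rewrite PoszD /llt_term; case: (posnP j) => [->|j_gt0].
    have -> : k%:Z - 0%N%:Z = k by lia.
    have -> : llt_walk q xs (- 0%N%:Z) k k = llt_walk q xs 1 k k.
      by rewrite llt_walk_swap.
    rewrite (llt_walkE q_neq0 (L := k)) ?ltr01 //; last by lia.
    by congr (q ^ _ *: _); lia.
  rewrite (llt_walkE q_neq0 (L := k)); [|lia|lia].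
  have -> : (0 < - j%:Z) = false by lia.
  by rewrite scalerA -expfzDr //; congr (q ^ _ *: _); lia.
rewrite /llt_walk -sum_sets_walk -(sum_two_columns (heights_bij k_gt0 le_jk) (fun A B =>
  (\prod_i walk_weight (fun D : int => if D <= 0 then q else 1)
      (fun D : int => if 0 < D then q else 1) (fun=> q) (i \in A, i \in B)
      (- j%:Z + #|[set w in A | (w < i)%N]|%:Z - #|[set w in B | (w < i)%N]|%:Z))
  *: (\prod_(i in A) x i * \prod_(i in B) x i))) scaler_sumr.
apply: eq_big => [T|T]; first by rewrite column_strict2.
rewrite column_strict2 // => colT.
have /andP[sL sR] := colT.
have colT' : column_strict (two_column_path k j) T by rewrite column_strict2 // colT.
have -> := @prod_llt_weights k j k_gt0 le_jk N T colT' F q.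
rewrite -(prod_two_columns (heights_bij k_gt0 le_jk) x sL sR) scalerA [q ^+ _]exprnP -expfzDr //.
by congr (q ^ _ *: _); rewrite PoszD; lia.
Qed.

Lemma sum_llt_term (tau c : nat -> F) k :
  c 0%N = tau 0%N -> (forall j, c j.+1 = q * c j + tau j.+1) ->
  \sum_(j < k.+1) tau j *: llt_term k j%:Z =
  \sum_(j < k.+1) c j *: (ee xs (k%:Z + j%:Z) (k%:Z - j%:Z)
                          - ee xs (k%:Z + j%:Z + 1) (k%:Z - j%:Z - 1)).
Proof.
move=> c0 cS.
have step j : llt_term k j%:Z = (ee xs (k%:Z + j%:Z) (k%:Z - j%:Z)
    - ee xs (k%:Z + j%:Z + 1) (k%:Z - j%:Z - 1)) + q *: llt_term k j.+1%:Z.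
  rewrite /llt_term llt_ee_step //; last by lia.
  congr (_ + q *: (q ^ _ *: llt_ee _ _ _ _ _ _)); lia.
have partial p : \sum_(j < p.+1) tau j *: llt_term k j%:Z =
    \sum_(j < p.+1) c j *: (ee xs (k%:Z + j%:Z) (k%:Z - j%:Z)
                          - ee xs (k%:Z + j%:Z + 1) (k%:Z - j%:Z - 1))
    + (q * c p) *: llt_term k p.+1%:Z.
  elim: p => [|p IH].
    by rewrite !big_ord1 -c0 step scalerDr scalerA mulrC.
  rewrite big_ord_recr IH [in RHS]big_ord_recr /= -addrA -scalerDl -cS step.
  by rewrite scalerDr scalerA addrA (mulrC q).
rewrite partial; have -> : llt_term k k.+1%:Z = 0; last by rewrite scaler0 addr0.
have es0 xs' (i : int) : i < 0 -> es xs' i = 0 :> V := @es_lt0 _ _ _.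
rewrite /llt_term /llt_ee /ee_sum big1 => [|i _]; last first.
  by rewrite /ee (es0 _ (_ - _)) ?mulr0 ?scaler0 //; lia.
by rewrite /ee (es0 _ (_ - _)) ?mulr0 ?scaler0 ?addr0 ?scaler0 //; lia.
Qed.

End SumInversions.

(** * Paths in the 2k x 2 rectangle *)

Section TwoRows.

Variable k : nat.
Hypothesis k_gt0 : (0 < k)%N.

Fact two_row_subproof0 : (0 < 2 * k)%N. Proof. by lia. Qed.
Fact two_row_subproof1 : (k < 2 * k)%N. Proof. by lia. Qed.

Definition two_row_path (a : 'I_k.+1) : {ffun 'I_2 -> 'I_(2 * k)} :=
  [ffun y => if y == ord0 then Ordinal two_row_subproof0
             else widen_ord two_row_subproof1 a].

Let one2 : 'I_2 := ord_max.

Lemma ord2_cases (y : 'I_2) : y = ord0 \/ y = one2.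
Proof. by case: y => -[|[|//]] h; [left | right]; apply/val_inj. Qed.

Lemma two_row_path0 a : two_row_path a ord0 = 0%N :> nat.
Proof. by rewrite ffunE. Qed.

Lemma two_row_path1 a : two_row_path a one2 = a :> nat.
Proof. by rewrite ffunE. Qed.

Lemma two_row_path_dyck a : dyck (two_row_path a).
Proof.
have := ltn_ord a; rewrite ltnS => le_a.
apply/andP; split; apply/forallP => y.
  case: (ord2_cases y) => ->; rewrite ?two_row_path0 ?two_row_path1 //=; lia.
apply/forallP => y'.
by case: (ord2_cases y) => ->; case: (ord2_cases y') => ->;
  rewrite ?two_row_path0 ?two_row_path1 ?leqnn.
Qed.

Lemma sum_dyck_two_row (V : nmodType) (G : {ffun 'I_2 -> 'I_(2 * k)} -> V) :
  \sum_(u | dyck u) G u = \sum_(a < k.+1) G (two_row_path a).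
Proof.
have inj : injective two_row_path.
  move=> a a' E; apply/val_inj => /=.
  have := congr1 (fun u : {ffun 'I_2 -> 'I_(2 * k)} => u one2 : nat) E.
  by rewrite !two_row_path1.
rewrite -(big_imset _ (in2W inj)) /=; apply: eq_bigl => u.
apply/idP/imsetP => [/andP[/forallP u_le _]|[a _ ->]]; last exact: two_row_path_dyck.
have u0 : u ord0 = 0%N :> nat by have := u_le ord0; rewrite muln0 leqn0 muln_eq0 => /orP[|/eqP].
have u1 : (u one2 < k.+1)%N by have := u_le one2; rewrite /= muln1 leq_pmul2l.
exists (Ordinal u1) => //; apply/ffunP => y; apply/val_inj.
by case: (ord2_cases y) => ->; rewrite /= ?two_row_path0 ?two_row_path1.
Qed.

Variable a : 'I_k.+1.

Let u := two_row_path a.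
Let le_ak : (a <= k)%N. Proof. by rewrite -ltnS. Qed.

Lemma two_row_rank0 : height_rank u ord0 = 0%N.
Proof. by rewrite /height_rank two_row_path0 /= !muln0 mul0n div0n. Qed.

Lemma two_row_rank1 : height_rank u one2 = (2 * (k - a) + (a == k :> nat))%N.
Proof.
have E : (a * gcdn (2 * k) 2 %/ (2 * k) = a %/ k)%N by rewrite gcdnC gcdnMr mulnC divnMl.
rewrite /height_rank two_row_path1 E /= muln1 -mulnBr; congr addn.
 case: (ltngtP a k) le_ak => // [lt_a|->] _; first by rewrite divn_small.
by rewrite divnn k_gt0.
Qed.

Lemma two_row_rank_lt : (height_rank u ord0 < height_rank u one2)%N.
Proof. by rewrite two_row_rank0 two_row_rank1; case: eqP; lia. Qed.

Lemma two_row_rank_inj : injective (height_rank u).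
Proof.
by move=> y y'; case: (ord2_cases y) => ->; case: (ord2_cases y') => -> // E;
  have := two_row_rank_lt; rewrite E ltnn.
Qed.

Lemma two_row_rank_col y y' : u y = u y' -> (y < y')%N ->
  (height_rank u y < height_rank u y')%N.
Proof.
move=> _; case: (ord2_cases y) => ->; case: (ord2_cases y') => -> //= _.
exact: two_row_rank_lt.
Qed.

Lemma card_pair_ord1 (P : pred ('I_(2 * k) * 'I_2)) :
  (forall x, ~~ P (x, ord0)) -> #|[set c | P c]| = #|[set x | P (x, one2)]|.
Proof.
move=> P0; have inj1 : injective (fun x : 'I_(2 * k) => (x, one2)) by move=> x x' [].
rewrite -[RHS](card_imset _ inj1); apply: eq_card => -[x y].
rewrite inE; apply/idP/imsetP => [Pxy|[x']]; last by rewrite inE => Px' [-> ->].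
case: (ord2_cases y) => E; last by exists x; rewrite ?inE -?E.
by case/negP: (P0 x); rewrite -E.
Qed.

Lemma two_row_area : area u = (k - a)%N.
Proof.
rewrite /area card_pair_ord1 => [|x]; last by rewrite /= muln0 leqn0 muln_eq0 /= andbF.
rewrite -(@card_ord_between (2 * k) a k); last by lia.
by apply: eq_card => x; rewrite !inE /= two_row_path1; lia.
Qed.

Lemma two_row_pdinv : pdinv u = a.
Proof.
have aboveE x y : ((x, y) \in above u) = (y == one2) && (x < a)%N.
  by rewrite inE /=; case: (ord2_cases y) => ->; rewrite ?two_row_path0 ?two_row_path1.
have armE x : (arm u (x, one2) <= k)%N.
  rewrite /arm card_pair_ord1 => [|x']; last by rewrite aboveE.
  apply: leq_trans (_ : #|[set x' : 'I_(2 * k) | (x' < a)%N]| <= k)%N.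
    apply/subset_leq_card/subsetP => x'; rewrite in_set aboveE inE.
    by case/andP=> /andP[].
  by rewrite card_ord_lt //; lia.
have legE x : leg u (x, one2) = 0%N.
  apply/eqP; rewrite cards_eq0; apply/eqP/setP => -[x' y].
  by rewrite [LHS]in_set aboveE in_set0 /=; case: (ord2_cases y) => ->; rewrite ?andbF.
rewrite /pdinv card_pair_ord1 => [|x]; last by rewrite aboveE.
rewrite -[RHS](@card_ord_lt (2 * k)); last by lia.
apply: eq_card => x; rewrite [LHS]in_set [RHS]in_set aboveE legE /= muln0 muln1 andbT.
by rewrite leq_pmul2l // armE andbT.
Qed.

Lemma two_row_ret : ret u = (if a == k :> nat then 1 else 2)%N.
Proof.
have pass1 : passes u k 1 = (a == k :> nat).
  apply/forallP/eqP => [H|ak z].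
    by have := H one2; rewrite two_row_path1 /=; lia.
  by case: (ord2_cases z) => ->; rewrite ?two_row_path0 ?two_row_path1 //= ak.
have pass2 : passes u (2 * k) 2.
  by apply/forallP => z; rewrite ltn_ord; exact: ltnW.
rewrite /ret gcdnC gcdnMr mulKn // divnn /= !mul1n !muln1 pass1 pass2.
by case: (a == k :> nat).
Qed.

Lemma two_row_tdinv (s : {perm 'I_2}) :
  tdinv (u, s) = (0 < a)%N && (s^-1%g ord0 < s^-1%g one2)%N.
Proof.
have lt_rank : (height_rank u one2 < 2 * k)%N = (0 < a)%N.
  by rewrite two_row_rank1; case: eqP; lia.
have -> : tdinv (u, s) = #|[set yy : 'I_2 * 'I_2 | (s^-1%g yy.1 < s^-1%g yy.2)%N &&
     (height_rank u yy.1 < height_rank u yy.2 < height_rank u yy.1 + 2 * k)%N]|.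
  have inj : injective (fun ij : 'I_2 * 'I_2 => (s ij.1, s ij.2)).
    by move=> [i i'] [l l'] [/perm_inj -> /perm_inj ->].
  rewrite /tdinv -(card_imset _ inj); apply: eq_card => -[y y'].
  rewrite inE /=; apply/imsetP/idP => [[[i i']]|H].
    by rewrite inE /= !rankE => H [-> ->]; rewrite !permK.
  by exists (s^-1%g y, s^-1%g y'); rewrite ?inE /= ?rankE !permKV.
rewrite -sum1dep_card big_mkcond (bigD1 (ord0, one2)) //= big1 ?addn0 => [|[y y'] ne].
  by rewrite two_row_rank_lt two_row_rank0 add0n lt_rank /= andbC; case: ifP.
move: ne; case: (ord2_cases y) => ->; case: (ord2_cases y') => -> //= _.
- by rewrite ltnn.
- by rewrite [X in _ && (X && _)]ltnNge (ltnW two_row_rank_lt) andbF.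
- by rewrite ltnn.
Qed.

Lemma two_row_maxdinv : maxdinv u = (0 < a)%N.
Proof.
apply/eqP; rewrite eqn_leq; apply/andP; split.
  apply/bigmax_leqP => -[v s] /= /andP[_ /eqP ->]; rewrite two_row_tdinv.
  by case: (0 < a)%N; rewrite ?leq_b1.
have [s [sK _]] := sort_perm two_row_rank_inj.
have ps : parking (u, s).
  rewrite /parking two_row_path_dyck //=; apply/forallP => i; apply/forallP => i'.
  apply/implyP => /andP[/eqP ueq lt_s]; rewrite -(permK s i) -(permK s i') sK.
  exact: two_row_rank_col.
apply: leq_trans (leq_bigmax_cond (P := fun pi => parking pi && (pi.1 == u)) (u, s) _).
  by rewrite two_row_tdinv sK two_row_rank_lt andbT.
by rewrite ps eqxx.
Qed.

End TwoRows.

(** * Comparison *)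

Section QtCoefficients.

Variables (F : fieldType) (q t : F).
Hypotheses (q_neq_t : q - t != 0) (t_neq0 : t != 0).

Definition ret_weight (j : nat) : F := if j is j'.+1 then t ^+ j + t ^+ j' else 1.

Definition qt_coef (j : nat) : F := qtH q t j.+1 + qtH q t j.

Lemma ret_weightE j :
  (\sum_(i < if j == 0 then 1 else 2) t ^- i) * t ^+ j = ret_weight j.
Proof.
case: j => [|j]; first by rewrite big_ord1 expr0 invr1 mulr1.
rewrite /= !big_ord_recl big_ord0 addr0 expr0 invr1 expr1 mulrDl mul1r.
by rewrite [in X in _ + X]exprS mulrA mulVf // mul1r.
Qed.

Lemma qt_coef_0 : qt_coef 0 = ret_weight 0.
Proof. by rewrite /qt_coef qtH1 // qtH0 addr0. Qed.

Lemma qt_coefS j : qt_coef j.+1 = q * qt_coef j + ret_weight j.+1.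
Proof. by rewrite /qt_coef /qtH /ret_weight !exprS; field. Qed.

Lemma sum_ret_weight k : \sum_(a < k.+1) ret_weight (k - a) * q ^+ a = qt_coef k.
Proof.
elim: k => [|k IH]; first by rewrite big_ord1 expr0 mulr1 qt_coef_0.
rewrite big_ord_recl subn0 expr0 mulr1 qt_coefS -IH addrC mulr_sumr; congr (_ + _).
by apply: eq_bigr => i _; rewrite lift0 subSS exprS mulrCA.
Qed.

End QtCoefficients.

Lemma qtschur_pred n : qtschur (n%:Z - 1) 0 = qtH q t n.
Proof.
rewrite /qtschur; case: n => [|n]; first by rewrite qtH0.
have -> : (0 <= 0 :> int) && (0 <= n.+1%:Z - 1) = true by lia.
have -> : n.+1%:Z - 1 - 0 + 1 = n.+1%:Z by lia.
by rewrite expr0z mul1r.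
Qed.

Section InVars.

Variable N : nat.

Lemma in_varsE F : in_vars N F =
  psubst (in_alg (mpoly N Qqt)) (fun r => \sum_(i < N) 'X_i ^+ r) F.
Proof. by []. Qed.

Lemma in_varsD F G : in_vars N (F + G) = in_vars N F + in_vars N G.
Proof. by rewrite in_varsE psubstD. Qed.

Lemma in_vars0 : in_vars N 0 = 0.
Proof. by rewrite in_varsE psubst0. Qed.

Lemma in_varsM F G : in_vars N (F * G) = in_vars N F * in_vars N G.
Proof. by rewrite in_varsE psubstM. Qed.

Lemma in_varsZ c F : in_vars N (c *: F) = c *: in_vars N F.
Proof. by rewrite in_varsE psubstZ mulr_algl. Qed.

Lemma in_varsB F G : in_vars N (F - G) = in_vars N F - in_vars N G.
Proof. by rewrite in_varsD -scaleN1r in_varsZ scaleN1r. Qed.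

Lemma in_vars_sum (I : Type) (s : seq I) (F : I -> Defs.Sym) :
  in_vars N (\sum_(i <- s) F i) = \sum_(i <- s) in_vars N (F i).
Proof. exact: (big_morph _ in_varsD in_vars0). Qed.

End InVars.

Section Images.

Variables (N : nat).

Let xs : seq (mpoly N Qqt) := [seq 'X_i | i <- enum 'I_N].

Lemma in_vars_elem2 a b : in_vars N (elem a * elem b) = ee xs a%:Z b%:Z.
Proof. by rewrite in_varsM !in_vars_elem. Qed.

Lemma sum_parking m n (G : PFtype m n -> mpoly N Qqt) :
  \sum_(pi | parking pi) G pi =
  \sum_(u | dyck u) \sum_(s : {perm 'I_n} | parking (u, s)) G (u, s).
Proof.
rewrite pair_big_dep /=; apply: eq_big => [[u s]|[u s] _] //.
by rewrite /parking /=; case: (dyck u).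
Qed.

Lemma Hpoly_2_2k k : (0 < k)%N -> Hpoly N 2 (2 * k) =
  \sum_(j < k.+1) qt_coef q t j *: (ee xs (k%:Z + j%:Z) (k%:Z - j%:Z)
                                - ee xs (k%:Z + j%:Z + 1) (k%:Z - j%:Z - 1)).
Proof.
move=> k_gt0; rewrite -(sum_llt_term _ q_neq0 _ (qt_coef_0 q_neq_t) (qt_coefS q_neq_t)).
rewrite /Hpoly sum_parking sum_dyck_two_column //; apply: eq_bigr => j _.
have le_jk : (j <= k)%N by rewrite -ltnS.
set u := two_column_path k j.
pose d (T : {ffun 'I_(2 * k) -> 'I_N}) : Qqt :=
  ret_weight t j * q ^ ((inversions j T)%:Z + ((j : nat) == 0%N)%:Z - (k%:Z - j%:Z)).
have dE (s : {perm 'I_(2 * k)}) T : column_strict u T ->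
    (forall y y', (s^-1%g y < s^-1%g y')%N = read_before u T y y') ->
    (\sum_(i < ret u) t ^- i) * t ^+ area u * q ^ dinv (u, s) = d T.
  move=> colT sT; rewrite ret2 // area2 // ret_weightE ?t_neq0 // /d; congr (_ * q ^ _).
  rewrite /dinv maxdinv2 // pdinv2 // (tdinv_inversions k_gt0 le_jk sT).
  by case: ((j : nat) =P 0%N); lia.
have := sum_fundamental (two_column_path_dyck k_gt0 j) (height_rank2_inj k_gt0 le_jk)
  (@height_rank2_col k k_gt0 j le_jk) dE.
move=> ->; rewrite -(sum_inversions _ q_neq0 k_gt0 le_jk) scaler_sumr.
by apply: eq_bigr => T _; rewrite scalerA.
Qed.

End Images.

Section PairSums.

Variables (F : fieldType) (V : comAlgType F) (N : nat) (x : 'I_N -> V).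

Let xs := [seq x i | i <- enum 'I_N].

Lemma es0 (s : seq V) : es s 0 = 1.
Proof. exact: (newton_es s).1. Qed.

Lemma es1 (s : seq V) : es s 1 = \sum_(y <- s) y.
Proof.
have := (newton_es s).2 1%N; rewrite mulr1n big_ord1 expr0 mul1r es0 mul1r => ->.
by apply: eq_bigr => y _; rewrite expr1.
Qed.

Lemma walk_const1 (s : seq V) D a b :
  walk (fun=> 1) (fun=> 1) (fun=> 1) s D a b = ee s a b.
Proof.
elim: s D a b => [|y s IH] D a b; first by rewrite ee_nil.
by rewrite ee_cons /= !IH !scale1r.
Qed.

Lemma sum_pairs : \sum_(T : {ffun 'I_2 -> 'I_N}) \prod_y x (T y) = ee xs 1 1.
Proof.
rewrite -(bigA_distr_bigA (fun _ => x)) prodr_const card_ord /ee es1 big_map big_enum.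
by rewrite expr2.
Qed.

Lemma sum_increasing_pairs :
  \sum_(T : {ffun 'I_2 -> 'I_N} | (T ord0 < T ord_max)%N) \prod_y x (T y) = ee xs 2 0.
Proof.
pose psi (i : 'I_0) : 'I_2 := ord0.
have bij : bijective (columns (@id 'I_2) psi).
  by exists inl => // -[i|[]].
have := sum_sets_walk (fun=> 1) (fun=> 1) (fun=> 1) x 0 2 0.
rewrite walk_const1 => <-.
pose H (A B : {set 'I_N}) : V := (\prod_i walk_weight (fun=> 1) (fun=> 1) (fun=> 1)
   (i \in A, i \in B)
   (0 + #|[set w in A | (w < i)%N]|%:Z - #|[set w in B | (w < i)%N]|%:Z) : F)
  *: (\prod_(i in A) x i * \prod_(i in B) x i).
rewrite -(sum_two_columns bij H); apply: eq_big => [T|T lt_T].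
  apply/idP/andP => [lt_T|[/strictP sT _]]; last exact: sT.
  split; apply/strictP => i; last by case: i.
  by move=> i'; case: (ord2_cases i) => ->; case: (ord2_cases i') => ->.
have s2 : strict (T \o psi) by apply/strictP => -[].
have s1 : strict (T \o id).
  by apply/strictP => i i'; case: (ord2_cases i) => ->; case: (ord2_cases i') => ->.
rewrite /H -(prod_two_columns bij x s1 s2) [\prod_i walk_weight _ _ _ _ _]big1 ?scale1r // => i _.
by rewrite /walk_weight; case: ifP; case: ifP.
Qed.

End PairSums.

Lemma sum_column_strict_pairs (F : fieldType) (V : comAlgType F) N (x : 'I_N -> V) k
    (k_gt0 : (0 < k)%N) (a : 'I_k.+1) (q : F) : q != 0 ->
  let xs := [seq x i | i <- enum 'I_N] in
  \sum_(T : {ffun 'I_2 -> 'I_N} | column_strict (two_row_path k_gt0 a) T)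
     q ^ (a%:Z - (0 < a)%N%:Z + ((0 < a) && (T ord0 < T ord_max))%N%:Z)
       *: \prod_y x (T y)
  = q ^+ a *: ee xs 2 0
    + (if a is Ordinal a'.+1 _ then q ^+ a' else 0) *: (ee xs 1 1 - ee xs 2 0).
Proof.
move=> q_neq0 xs; have strictE (T : {ffun 'I_2 -> 'I_N}) : column_strict (two_row_path k_gt0 a) T =
    (0 < a)%N || (T ord0 < T ord_max)%N.
  apply/forallP/idP => [H|].
    have /forallP/(_ ord_max)/implyP := H ord0; rewrite -val_eqE /=.
    rewrite two_row_path0 two_row_path1; case: (posnP a) => [a0 lt_T|//].
    by rewrite lt_T ?a0.
  move=> H y; apply/forallP => y'.
  case: (ord2_cases y) => ->; case: (ord2_cases y') => ->; rewrite ?ltnn ?andbF //=.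
  rewrite andbT; apply/implyP => /eqP/(congr1 val) /=.
  rewrite two_row_path0 two_row_path1 => a0.
  by rewrite -a0 in H.
rewrite (eq_bigl _ _ strictE) -!(sum_increasing_pairs x) -sum_pairs.
case: a {strictE} => -[|a'] lt_a /=.
  rewrite scale0r !addr0 expr0 scale1r.
  apply: eq_bigr => T lt_T.
  exact: scale1r.
rewrite [X in _ *: (X - _)](bigID (fun T : {ffun 'I_2 -> 'I_N} => T ord0 < T ord_max)%N) /=.
rewrite [X in _ *: (X - _)]addrC addrK.
rewrite (bigID (fun T : {ffun 'I_2 -> 'I_N} => T ord0 < T ord_max)%N) /= !scaler_sumr.
congr (_ + _); apply: eq_bigr => T; [move=> -> | move/negPf => ->]; congr (_ *: _).
  by rewrite exprnP; congr (q ^ _); lia.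
by rewrite exprnP; congr (q ^ _); lia.
Qed.

Lemma Hpoly_2k_2 N k : let xs := [seq 'X_i | i <- enum 'I_N] : seq (mpoly N Qqt) in
  Hpoly N (2 * k.+1) 2 =
  qt_coef q t k *: (ee xs 1 1 - ee xs 2 0) + qt_coef q t k.+1 *: ee xs 2 0.
Proof.
move=> xs; have k_gt0 : (0 < k.+1)%N by [].
rewrite /Hpoly sum_parking (sum_dyck_two_row k_gt0).
transitivity (\sum_(a < k.+2) ret_weight t (k.+1 - a) *: (q ^+ a *: ee xs 2 0
    + (if a is Ordinal a'.+1 _ then q ^+ a' else 0) *: (ee xs 1 1 - ee xs 2 0))).
  apply: eq_bigr => a _; rewrite -(sum_column_strict_pairs _ k_gt0 a q_neq0).
  set u := two_row_path k_gt0 a.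
  pose d (T : {ffun 'I_2 -> 'I_N}) : Qqt := ret_weight t (k.+1 - a)
    * q ^ (a%:Z - (0 < a)%N%:Z + ((0 < a) && (T ord0 < T ord_max))%N%:Z).
  have dE (s : {perm 'I_2}) T : column_strict u T ->
      (forall y y', (s^-1%g y < s^-1%g y')%N = read_before u T y y') ->
      (\sum_(i < ret u) t ^- i) * t ^+ area u * q ^ dinv (u, s) = d T.
    move=> colT sT; rewrite two_row_ret two_row_area.
    have -> : (a == k.+1 :> nat) = (k.+1 - a == 0)%N by have := ltn_ord a; lia.
    rewrite ret_weightE ?t_neq0 // /d; congr (_ * q ^ _).
    rewrite /dinv two_row_maxdinv two_row_pdinv two_row_tdinv sT /read_before.
    rewrite [X in _ && (_ || _ && X)]ltnNge (ltnW (two_row_rank_lt k_gt0 a)) andbF orbF.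
    by lia.
  have := sum_fundamental (two_row_path_dyck k_gt0 a) (two_row_rank_inj (a := a))
    (@two_row_rank_col _ k_gt0 a) dE.
  move=> ->; rewrite scaler_sumr.
  by apply: eq_bigr => T _; rewrite scalerA.
transitivity ((\sum_(a < k.+2) ret_weight t (k.+1 - a) * q ^+ a) *: ee xs 2 0
   + (\sum_(a < k.+1) ret_weight t (k - a) * q ^+ a) *: (ee xs 1 1 - ee xs 2 0)).
  rewrite (eq_bigr (fun a : 'I_k.+2 => (ret_weight t (k.+1 - a) * q ^+ a) *: ee xs 2 0
    + (ret_weight t (k.+1 - a) * (if a is Ordinal a'.+1 _ then q ^+ a' else 0))
        *: (ee xs 1 1 - ee xs 2 0))) => [|a _]; last by rewrite scalerDr !scalerA.
  rewrite big_split /= -scaler_suml; congr (_ + _).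
  rewrite big_ord_recl mulr0 scale0r add0r scaler_suml.
  by apply: eq_bigr => i _; rewrite lift0 subSS.
by rewrite !(sum_ret_weight q_neq_t) addrC.
Qed.

Lemma schurE N (la : seq nat) b : (b <= size la)%N ->
  (forall i, (i < size la)%N -> nth 0%N la i = if (i < b)%N then 2 else 1%N) ->
  let xs := [seq 'X_i | i <- enum 'I_N] : seq (mpoly N Qqt) in
  schur N la = ee xs (size la) b - ee xs ((size la)%:Z + 1) (b%:Z - 1).
Proof.
move=> le_b la_i; exact: (sum_semistandard (fun i => 'X_i : mpoly N Qqt) le_b la_i).
Qed.

Lemma ee_lt0 (F : fieldType) (V : comAlgType F) (xs : seq V) a b : b < 0 -> ee xs a b = 0.
Proof. by move=> b0; rewrite /ee (es_lt0 _ b0) mulr0. Qed.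

Lemma schur_2 N : let xs := [seq 'X_i | i <- enum 'I_N] : seq (mpoly N Qqt) in
  schur N [:: 2] = ee xs 1 1 - ee xs 2 0.
Proof. by rewrite /= (@schurE N [:: 2] 1) // => -[]. Qed.

Lemma schur_11 N : let xs := [seq 'X_i | i <- enum 'I_N] : seq (mpoly N Qqt) in
  schur N [:: 1; 1]%N = ee xs 2 0.
Proof.
rewrite /= (@schurE N [:: 1; 1]%N 0) //; last by move=> [|[]].
by rewrite [X in _ - X]ee_lt0 // subr0.
Qed.

Lemma schur_2r1 N k j : (j <= k)%N ->
  let xs := [seq 'X_i | i <- enum 'I_N] : seq (mpoly N Qqt) in
  schur N (nseq (k - j) 2 ++ nseq (2 * k - 2 * (k - j)) 1)%N
  = ee xs (k%:Z + j%:Z) (k%:Z - j%:Z) - ee xs (k%:Z + j%:Z + 1) (k%:Z - j%:Z - 1).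
Proof.
move=> le_jk xs; have sz : size (nseq (k - j) 2 ++ nseq (2 * k - 2 * (k - j)) 1)%N = (k + j)%N.
  by rewrite size_cat !size_nseq; lia.
rewrite (@schurE N _ (k - j)) ?sz; last 2 first.
- by lia.
- move=> i lt_i; rewrite nth_cat size_nseq !nth_nseq.
  by case: (ltnP i (k - j)) => // le_i; rewrite ifT //; lia.
by have -> : (k - j)%N%:Z = k%:Z - j%:Z by lia.
Qed.

Lemma in_vars_comb N (a b : Qqt) (F G K : Defs.Sym) :
  in_vars N (a *: (F - G) + b *: K) =
  a *: (in_vars N F - in_vars N G) + b *: in_vars N K.
Proof.
apply: etrans (in_varsD N _ _) _; congr (_ + _); last exact: in_varsZ.
by apply: etrans (in_varsZ N _ _) _; congr (_ *: _); exact: in_varsB.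
Qed.

Lemma in_vars_Qop_2k_2 split (splitP : is_splitting split) N k :
  let xs := [seq 'X_i | i <- enum 'I_N] : seq (mpoly N Qqt) in
  in_vars N (Qop split (2 * k.+1) 2 1)
  = qt_coef q t k *: (ee xs 1 1 - ee xs 2 0) + qt_coef q t k.+1 *: ee xs 2 0.
Proof.
move=> xs; rewrite (Qop_2k_2 splitP) in_vars_comb.
have -> : in_vars N (elem 1 ^+ 2) = ee xs 1 1 by rewrite expr2 in_vars_elem2.
have -> : in_vars N (elem 2) = ee xs 2 0 by rewrite in_vars_elem /ee es0 mulr1.
reflexivity.
Qed.

Lemma in_vars_Qop_2_2k split (splitP : is_splitting split) N k : (0 < k)%N ->
  let xs := [seq 'X_i | i <- enum 'I_N] : seq (mpoly N Qqt) in
  in_vars N (Qop split 2 (2 * k) 1)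
  = \sum_(j < k.+1) qt_coef q t j *: (ee xs (k%:Z + j%:Z) (k%:Z - j%:Z)
                                - ee xs (k%:Z + j%:Z + 1) (k%:Z - j%:Z - 1)).
Proof.
move=> k_gt0 xs; rewrite (Qop_2_2k splitP k_gt0) in_vars_sum; apply: eq_bigr => j _.
have le_jk : (j <= k)%N by rewrite -ltnS.
apply: etrans (in_varsZ N _ _) _; congr (_ *: _).
apply: etrans (in_varsB N _ _) _; congr (_ - _).
  rewrite le_jk; apply: etrans (in_vars_elem2 N _ _) _; congr (ee xs _ _); lia.
case: leqP => [le_k|lt_j].
  by apply: etrans (in_vars0 N) (esym (ee_lt0 _ _ _)); lia.
apply: etrans (in_vars_elem2 N _ _) _; congr (ee xs _ _); lia.
Qed.

Theorem theorem2 (split : nat -> nat -> nat * nat) (splitP : is_splitting split)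
    (k : nat) (k_gt0 : (0 < k)%N) (N : nat) :
  (in_vars N (Qop split (2 * k) 2 1) = Hpoly N (2 * k) 2
   /\ Hpoly N (2 * k) 2 =
        (qtschur (k%:Z - 1) 0 + qtschur (k%:Z - 2) 0) *: schur N [:: 2%N]
        + (qtschur k%:Z 0 + qtschur (k%:Z - 1) 0) *: schur N [:: 1%N; 1%N])
  /\
  (in_vars N (Qop split 2 (2 * k) 1) = Hpoly N 2 (2 * k)
   /\ Hpoly N 2 (2 * k) =
        \sum_(r < k.+1)
          (qtschur (k%:Z - r%:Z) 0 + qtschur (k%:Z - r%:Z - 1) 0)
            *: schur N (nseq r 2%N ++ nseq (2 * k - 2 * r) 1%N)).
Proof.
split; last split.
- case: k k_gt0 => // k _; split; first by rewrite (in_vars_Qop_2k_2 splitP) Hpoly_2k_2.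
  rewrite Hpoly_2k_2 schur_2 schur_11; congr (_ *: _ + _ *: _).
    have -> : k.+1%:Z - 2 = k%:Z - 1 by lia.
    by rewrite !qtschur_pred.
  have -> : qtschur k.+1%:Z 0 = qtschur (k.+2%:Z - 1) 0 by congr qtschur; lia.
  by rewrite !qtschur_pred.
- by rewrite (in_vars_Qop_2_2k splitP) // Hpoly_2_2k.
rewrite Hpoly_2_2k // [RHS](reindex_inj rev_ord_inj) /=; apply: eq_bigr => j _.
have le_jk : (j <= k)%N by rewrite -ltnS.
rewrite subSS schur_2r1 //; congr (_ *: _).
have -> : k%:Z - (k - j)%N%:Z - 1 = j%:Z - 1 by lia.
have -> : k%:Z - (k - j)%N%:Z = j.+1%:Z - 1 by lia.
by rewrite !qtschur_pred.
Qed.
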